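(* Let $\mathbb{F}_\ell$ be a finite field and $n\ge1$ an integer such that $\operatorname{char}(\mathbb{F}_\ell)>\frac n2$. Let $F:=\mathbb{F}_\ell((t))$, and let $p:\mathfrak{gl}_n\to\underline{\mathfrak c}$ be the Chevalley map. Then for any smooth compactly supported measure $\mu$ on $\mathfrak{gl}_n(F)$, the measure $p_*(\mu)$ on $\mathfrak c:=\underline{\mathfrak c}(F)$ can be written as a product of a function in $L^\infty(\mathfrak c)$ and a Haar measure on $\mathfrak c$.
   Context: $\underline{\mathfrak c}$ is the affine space (over $\mathbb{F}_\ell$) of monic polynomials of degree $n$, identified with $\mathbb{A}^n$ via coefficients, and $p$ sends a matrix to its characteristic polynomial. A smooth measure on $F^N$ is a locally constant function times a Haar measure. *)

(* Defs.v *)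
From HB Require Import structures.
From mathcomp Require Import all_boot all_order all_algebra.
From mathcomp Require Import all_classical all_reals all_analysis.
From mathcomp Require Import complex.
From mathcomp Require Import ring zify.

Set Implicit Arguments.
Unset Strict Implicit.
Unset Printing Implicit Defensive.

Import Order.TTheory GRing.Theory Num.Theory.

Local Open Scope classical_set_scope.
Local Open Scope ring_scope.

(* [below f a]: all the coefficients of t^m with m < a vanish. *)
Definition below (k : nmodType) (f : int -> k) (a : int) :=
  forall m : int, m < a -> f m = 0.

(* The field k((t)) of formal Laurent series: [lcoef f m] is the coefficient of
   t^m, and only finitely many coefficients of negative index are nonzero. *)
Record laurent (k : fieldType) := Laurent {
  lcoef :> int -> k;
  _ : `[< exists a, below lcoef a >] }.

HB.instance Definition _ (k : fieldType) := [isSub for @lcoef k].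
HB.instance Definition _ (k : fieldType) := [Choice of laurent k by <:].

Section LaurentRing.
Variable k : fieldType.
Implicit Types (f g h : int -> k) (x y z : laurent k) (a b c m : int).

Lemma laurent_below x : exists a, below x a.
Proof. by case: x => f xf; exact/asboolP. Qed.

Lemma laurentP x y : (x : int -> k) =1 y <-> x = y.
Proof. by split=> [xy|->//]; apply/val_inj/funext. Qed.

Lemma below_le f a b : b <= a -> below f a -> below f b.
Proof. by move=> ba fa m /lt_le_trans/(_ ba)/fa. Qed.

Definition mkl f a (fa : below f a) : laurent k :=
  @Laurent k f (asboolT (ex_intro (below f) a fa)).

Lemma laurent_exD f g : (exists a, below f a) -> (exists b, below g b) ->
  exists a, below f a /\ below g a.
Proof.
move=> [a fa] [b gb]; exists (Num.min a b).
by split; [apply: below_le fa|apply: below_le gb]; rewrite ge_min lexx ?orbT.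
Qed.

Fact ladd_subproof x y : `[< exists a, below (fun m => x m + y m) a >].
Proof.
apply/asboolP; have [a [xa ya]] := laurent_exD (laurent_below x) (laurent_below y).
by exists a => m ma; rewrite xa// ya// addr0.
Qed.
Definition ladd x y := Laurent (ladd_subproof x y).

Fact lopp_subproof x : `[< exists a, below (fun m => - x m) a >].
Proof.
apply/asboolP; have [a xa] := laurent_below x.
by exists a => m ma; rewrite xa// oppr0.
Qed.
Definition lopp x := Laurent (lopp_subproof x).

Fact lzero_subproof : `[< exists a, below (fun=> 0 : k) a >].
Proof. by apply/asboolP; exists 0. Qed.
Definition lzero := Laurent lzero_subproof.

Fact laddA : associative ladd.
Proof. by move=> x y z; apply/laurentP => m; exact: addrA. Qed.
Fact laddC : commutative ladd.
Proof. by move=> x y; apply/laurentP => m; exact: addrC. Qed.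
Fact ladd0 : left_id lzero ladd.
Proof. by move=> x; apply/laurentP => m; exact: add0r. Qed.
Fact laddN : left_inverse lzero lopp ladd.
Proof. by move=> x; apply/laurentP => m; exact: addNr. Qed.
HB.instance Definition _ :=
  GRing.isZmodule.Build (laurent k) laddA laddC ladd0 laddN.

(* The Cauchy product; the sum over all i in Z has finite support whenever f
   and g are bounded below. *)
Definition conv f g m : k := \sum_(i \in [set: int]) f i * g (m - i).

Lemma conv_below f g a b : below f a -> below g b -> below (conv f g) (a + b).
Proof.
move=> fa gb m mab; apply: fsbig1 => i _.
have [ia|ai] := ltP i a; first by rewrite fa// mul0r.
by rewrite gb ?mulr0//; lia.
Qed.

(* On products, Laurent series bounded below behave like truncated
   polynomials. *)
Definition trunc f a (s : nat) : {poly k} := \poly_(i < s.+1) f (a + i%:Z).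

Lemma coef_trunc f a s i : (i <= s)%N -> (trunc f a s)`_i = f (a + i%:Z).
Proof. by move=> si; rewrite coef_poly ltnS si. Qed.

Lemma convE f g a b (s j : nat) : below f a -> below g b -> (j <= s)%N ->
  conv f g (a + b + j%:Z) = (trunc f a s * trunc g b s)`_j.
Proof.
move=> fa gb js; rewrite coefM.
under eq_bigr => i _.
  rewrite !coef_trunc//; first last.
  - by apply: leq_trans js; rewrite -ltnS.
  - by apply: leq_trans js; rewrite leq_subr.
  over.
rewrite (fsbig_ord _ _ (fun i : nat => f (a + i%:Z) * g (b + (j - i)%N%:Z))).
rewrite /conv -(fsbig_widen [set a + i%:Z | i in `I_j.+1])//; last first.
  move=> i [_ /= ni].
  have [ia|ai] := ltP i a; first by rewrite fa// mul0r.
  have [ij|ji] := leP i (a + j%:Z).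
    exfalso; apply: ni; exists `|i - a|%N => /=; lia.
  by rewrite gb ?mulr0//; lia.
rewrite fsbig_image; last by move=> u v _ _; lia.
by apply: eq_fsbigr => i; rewrite inE/= => ij; congr (_ * g _); lia.
Qed.

Lemma trunc_conv f g a b s i : below f a -> below g b -> (i <= s)%N ->
  (trunc (conv f g) (a + b) s)`_i = (trunc f a s * trunc g b s)`_i.
Proof. by move=> fa gb si; rewrite coef_trunc//; exact: convE. Qed.

Lemma eq_below f g a : below f a -> below g a ->
  (forall s : nat, f (a + s%:Z) = g (a + s%:Z)) -> f =1 g.
Proof.
move=> fa ga fg m; have [ma|am] := ltP m a; first by rewrite fa// ga.
by have -> : m = a + `|m - a|%N%:Z by lia.
Qed.

Lemma coefM_eql (p p' q : {poly k}) s :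
  (forall i, (i <= s)%N -> p`_i = p'`_i) -> (p * q)`_s = (p' * q)`_s.
Proof.
by move=> pp; rewrite !coefM; apply: eq_bigr => i _; rewrite pp// -ltnS.
Qed.

Lemma coefM_eqr (p p' q : {poly k}) s :
  (forall i, (i <= s)%N -> p`_i = p'`_i) -> (q * p)`_s = (q * p')`_s.
Proof. by rewrite ![q * _]mulrC; exact: coefM_eql. Qed.

Fact lmul_subproof x y : `[< exists a, below (conv x y) a >].
Proof.
apply/asboolP; have [a xa] := laurent_below x.
have [b yb] := laurent_below y; exists (a + b); exact: conv_below.
Qed.
Definition lmul x y := Laurent (lmul_subproof x y).

Definition lone_coef m : k := (m == 0)%:R.
Lemma lone_below : below lone_coef 0.
Proof. by move=> m m0; rewrite /lone_coef lt_eqF. Qed.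
Definition lone := mkl lone_below.

Fact lmulA : associative lmul.
Proof.
move=> x y z; apply/laurentP.
have [a xa] := laurent_below x; have [b yb] := laurent_below y.
have [c zc] := laurent_below z.
have abc : a + (b + c) = a + b + c by rewrite addrA.
have yz := conv_below yb zc; have xy := conv_below xa yb.
apply: (@eq_below _ _ (a + b + c)).
- by rewrite -abc; exact: conv_below.
- exact: conv_below.
- move=> s /=; rewrite (convE xy zc (leqnn s)) -abc (convE xa yz (leqnn s)).
  rewrite (coefM_eqr _ (fun i => @trunc_conv y z b c s i yb zc)).
  by rewrite (coefM_eql _ (fun i => @trunc_conv x y a b s i xa yb)) mulrA.
Qed.

Fact lmulC : commutative lmul.
Proof.
move=> x y; apply/laurentP.
have [a xa] := laurent_below x; have [b yb] := laurent_below y.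
apply: (@eq_below _ _ (a + b)); first exact: conv_below.
  by rewrite addrC; exact: conv_below.
move=> s /=; rewrite (convE xa yb (leqnn s)) [in RHS](addrC a).
by rewrite (convE yb xa (leqnn s)) mulrC.
Qed.

Fact lmul1 : left_id lone lmul.
Proof.
move=> x; apply/laurentP; have [a xa] := laurent_below x.
apply: (@eq_below _ _ (0 + a)) => /=.
- exact: conv_below lone_below xa.
- by rewrite add0r.
- move=> s; rewrite (convE lone_below xa (leqnn s)) (_ : trunc _ 0 s = 1).
    by rewrite mul1r coef_trunc// add0r.
  apply/polyP => -[|i]; rewrite coef_poly coef1 /lone_coef//=.
  by case: ifP => // _; rewrite add0r.
Qed.

Fact lmulD : left_distributive lmul +%R.
Proof.
move=> x y z; apply/laurentP.
have [a [xa ya]] := laurent_exD (laurent_below x) (laurent_below y).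
have [c zc] := laurent_below z.
have xya : below (x + y : laurent k) a by move=> m ma; rewrite /= xa// ya// addr0.
have xz := conv_below xa zc; have yz := conv_below ya zc.
apply: (@eq_below _ _ (a + c)).
- exact: conv_below.
- by move=> m ma; rewrite /= xz// yz// addr0.
- move=> s /=; rewrite (convE xya zc (leqnn s)) (convE xa zc (leqnn s)).
  rewrite (convE ya zc (leqnn s)) -coefD -mulrDl.
  by apply: coefM_eql => i si; rewrite coefD !coef_trunc.
Qed.

Fact lone_neq0 : lone != 0.
Proof.
apply/eqP => /laurentP/(_ 0) /=; rewrite /lone_coef eqxx.
exact/eqP/oner_neq0.
Qed.

HB.instance Definition _ := GRing.Zmodule_isComNzRing.Build (laurent k)
  lmulA lmulC lmul1 lmulD lone_neq0.

Lemma laurent_lead x : x != 0 -> exists2 a, below x a & x a != 0.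
Proof.
move=> x0; have [b xb] := laurent_below x.
have ex : exists i : nat, x (b + i%:Z) != 0.
  apply: contrapT => /forallNP n; move/eqP: x0; apply; apply/laurentP.
  apply: (eq_below xb) => // s; move/negP: (n s).
  by rewrite negbK => /eqP.
have [i xi imin] := ex_minnP ex; exists (b + i%:Z) => // m mi.
have [mb|bm] := ltP m b; first exact: xb.
apply/eqP; apply: contraT => xm.
have := imin `|m - b|%N; rewrite (_ : b + _ = m); last by lia.
by move/(_ xm); lia.
Qed.

Fixpoint pinv_seq (u : nat -> k) (s : nat) : seq k :=
  if s is s'.+1 then
    let l := pinv_seq u s' in
    rcons l (((s' == 0%N)%:R - \sum_(j < s') l`_j * u (s' - j)%N) / u 0%N)
  else [::].

Lemma size_pinv_seq u s : size (pinv_seq u s) = s.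
Proof. by elim: s => //= s IH; rewrite size_rcons IH. Qed.

Lemma nth_pinv_seq u s j : (j < s)%N -> (pinv_seq u s)`_j = (pinv_seq u j.+1)`_j.
Proof.
elim: s => // s IH; rewrite ltnS leq_eqVlt => /predU1P[->//|js].
by rewrite [pinv_seq u s.+1]/= nth_rcons size_pinv_seq js IH.
Qed.

Lemma pinv_seqE u s : u 0%N != 0 ->
  \sum_(j < s.+1) (pinv_seq u j.+1)`_j * u (s - j)%N = (s == 0%N)%:R.
Proof.
move=> u0; rewrite big_ord_recr /= subnn nth_rcons size_pinv_seq ltnn eqxx.
rewrite divfK//; under eq_bigr => j _.
  by rewrite -[rcons _ _]/(pinv_seq u j.+1) -(nth_pinv_seq u (ltn_ord j)); over.
by rewrite addrC subrK.
Qed.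

Lemma laurent_inv_ex x : x != 0 -> exists y : laurent k, y * x = 1.
Proof.
move=> /laurent_lead[a xa xa0].
pose u (i : nat) := x (a + i%:Z).
pose v m := if m < - a then 0 else (pinv_seq u (absz (m + a)).+1)`_(absz (m + a)).
have va : below v (- a) by move=> m ma; rewrite /v ma.
exists (mkl va); apply/laurentP => /=.
apply: (@eq_below _ _ (- a + a)).
- exact: conv_below.
- by rewrite addNr; exact: lone_below.
- move=> s; rewrite (convE va xa (leqnn s)) addNr add0r /lone_coef.
  rewrite coefM -[RHS](@pinv_seqE u s) ?/u ?addr0//.
  apply: eq_bigr => i _; have si : (i <= s)%N by rewrite -ltnS.
  rewrite (coef_trunc v _ si) (coef_trunc x a (leq_subr i s)).
  have ai : absz (- a + i%:Z + a) = i by lia.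
  by rewrite /v ai ifF//; apply/negbTE; rewrite -leNgt lerDl.
Qed.

(* The inverse, picked out among the (at most one) y with y * x = 1. *)
Definition linv x : laurent k := xget 0 [set y : laurent k | y * x = 1].

Fact lmulV x : x != 0 -> linv x * x = 1.
Proof. by move=> /laurent_inv_ex[y yx]; rewrite /linv; case: xgetP => // /(_ y). Qed.

Fact linv0 : linv 0 = 0.
Proof.
rewrite /linv; case: xgetP => // y _ /=; rewrite mulr0 => /eqP.
by rewrite eq_sym oner_eq0.
Qed.

HB.instance Definition _ := GRing.ComNzRing_isField.Build (laurent k) lmulV linv0.

End LaurentRing.

Section LaurentTopology.
Variable k : fieldType.
Local Open Scope relation_scope.
Implicit Types A : set (laurent k * laurent k).

(* The t-adic uniformity, generated by the relations x - y \in t^N k[[t]]. *)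
Definition tadic_rel (N : int) : set (laurent k * laurent k) :=
  [set xy | below (xy.1 - xy.2 : laurent k) N].

Definition tadic_ent : set_system (laurent k * laurent k) :=
  filter_from [set: int] tadic_rel.

Fact tadic_filter : Filter tadic_ent.
Proof.
apply: filter_from_filter; first by exists 0.
move=> M N _ _; exists (Num.max M N) => // xy xyMN.
by split; apply: below_le xyMN; rewrite le_max lexx ?orbT.
Qed.

Fact tadic_refl A : tadic_ent A -> diagonal `<=` A.
Proof.
move=> [N _ NA] [x y] xy; have -> : x = y by [].
by apply: NA => m _; exact: subrr.
Qed.

Fact tadic_inv A : tadic_ent A -> tadic_ent A^-1.
Proof.
move=> [N _ NA]; exists N => // -[x y] xy; apply: (NA (y, x)) => m mN /=.
by rewrite -opprB -[_ - _]/((x - y) m) xy// oppr0.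
Qed.

Fact tadic_split A : tadic_ent A -> exists2 B, tadic_ent B & B \; B `<=` A.
Proof.
move=> [N _ NA]; exists (tadic_rel N); first by exists N.
move=> [x z] [y /= xy yz]; apply: NA => m mN /=.
rewrite (_ : x m - z m = (x - y) m + (y - z) m); last by rewrite /=; ring.
by rewrite xy// yz// addr0.
Qed.

HB.instance Definition _ := isUniform.Build (laurent k)
  tadic_filter tadic_refl tadic_inv tadic_split.
HB.instance Definition _ := isPointed.Build (laurent k) 0.
End LaurentTopology.

Definition borel (T : ptopologicalType) := g_sigma_algebraType (@open T).
HB.instance Definition _ (T : ptopologicalType) := Measurable.on (borel T).

Definition locally_constant (T : topologicalType) (U : Type) (f : T -> U) :=
  forall x, \forall y \near x, f y = f x.

Definition compactly_supported (T : topologicalType) (U : zmodType)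
    (f : T -> U) :=
  compact (closure [set x | f x != 0]).

Section ComplexMeasures.
Local Open Scope complex_scope.
Context d (T : measurableType d) (R : realType).
Variable nu : {measure set T -> \bar R}.
Implicit Types g : T -> R[i].

Definition cmeasurable g :=
  measurable_fun [set: T] (fun x => complex.Re (g x)) /\
  measurable_fun [set: T] (fun x => complex.Im (g x)).

Definition cintegrable g :=
  nu.-integrable [set: T] (fun x => (complex.Re (g x))%:E) /\
  nu.-integrable [set: T] (fun x => (complex.Im (g x))%:E).

Definition cintegral (A : set T) g : R[i] :=
  (\int[nu]_(x in A) complex.Re (g x)) +i* (\int[nu]_(x in A) complex.Im (g x)).

(* The complex measure mu is the product of the function g and the measure nu;
   only the values of mu at measurable sets matter. *)
Definition has_density (mu : set T -> R[i]) g :=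
  cintegrable g /\ forall A, measurable A -> mu A = cintegral A g.

Definition Linfty g :=
  cmeasurable g /\ finite_norm nu +oo%E (fun x => complex.Re `|g x|).
End ComplexMeasures.

Section Haar.
Variables (R : realType) (k : fieldType) (m n : nat).
Local Notation V := 'M[laurent k]_(m, n).

(* Haar measures on the additive group V. Regularity is automatic for a Borel
   measure finite on compact sets when k is finite, as V is then locally
   compact and second countable. *)
Definition is_haar (nu : {measure set (borel V) -> \bar R}) :=
  [/\ (forall (v : V) (A : set (borel V)), measurable A ->
        nu [set v + x | x in A] = nu A),
      (forall K : set V, compact K -> (nu K < +oo)%E) &
      nu [set: V] != 0%E].

Definition smooth_cs_measure (mu : set (borel V) -> R[i]) :=
  exists (nu : {measure set (borel V) -> \bar R}) (f : V -> R[i]),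
    [/\ is_haar nu, locally_constant f, compactly_supported f &
        has_density nu mu f].
End Haar.

(* A monic polynomial 'X^n + \sum_(i < n) c_i 'X^i is identified with
   the row of its non-leading coefficients. *)
Definition chevalley (F : fieldType) (n : nat) (M : 'M[F]_n) : 'rV[F]_n :=
  \row_(i < n) (char_poly M)`_i.

(* Main.v *)
Require Import Defs.
From HB Require Import structures.
From mathcomp Require Import all_boot all_order all_algebra.
From mathcomp Require Import all_classical all_reals all_analysis.
From mathcomp Require Import measurable_realfun ess_sup_inf.
From mathcomp Require Import complex perm.
From mathcomp Require Import ring lra zify.

(* Let q = #|k|. By Radon-Nikodym it suffices to bound the Haar measure of the
   matrices X in t^-s M_n(k[[t]]) whose characteristic polynomial lies in a
   given ball of radius q^-N by C q^(-N n); after scaling and truncation this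
   is a count over Q = k[t]/(t^(M+1)).

   The first row of a matrix over Q, without its corner, is t^d e0 G with G
   invertible, so conjugation by the stabilizer of the first basis vector turns
   X into
       hext (t^d) Y b a = [ a  t^d e0 ]
                          [ b    Y    ].
   Iterating on Y, averages of conjugation invariant functions become sums over
   exponents d_1, d_2, ... of weighted averages over Hessenberg matrices. As
       char_poly (hext tau Y b a)
         = ('X - a) * char_poly Y - tau * (rho Y *m b),
   where rho Y is the first row of the adjugate of 'X - Y, the number of (b, a)
   with a given value f of this polynomial is at most the inverse of the weight
   of d, and it is 0 unless f lies in the ideal J_d(Y) = (t^d rho Y, char_poly Y).

   It remains to bound, for fixed f, the average over Y of #{d : f in J_d(Y)},
   which is done by induction on the size. These ideals decrease when Y is
   extended to Z = hext (t^d) Y b a, and if f is in J_d(Y), say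
   f = t^d * (rho Y *m c) + char_poly Y * g, then comparing the coordinates of
   f along rho Z shows that f in J_d'(Z) forces t^d' to divide psi(a), for a
   monic polynomial psi of degree deg g <= n not depending on a. Such an a has
   density at most n q^(- floor (d' / n)), which is summable over d'. The exponents
   d > D only contribute O(q^-D), and D is at our disposal. *)

Set Implicit Arguments.
Unset Strict Implicit.
Unset Printing Implicit Defensive.

Import Order.TTheory GRing.Theory Num.Theory.

Local Open Scope ring_scope.

(** * Bordered matrices and the ideals J *)

Definition e0 (A : comNzRingType) m : 'rV[A]_m := \row_j (j == 0 :> nat)%:R.
Arguments e0 {A} m.

Definition hext (A : comNzRingType) m (tau : A) (Y : 'M[A]_m) (b : 'cV[A]_m)
    (a : A) : 'M[A]_m.+1 :=
  block_mx a%:M (tau *: e0 m) b Y : 'M[_]_(1 + m).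

Definition rho (A : comNzRingType) m (Y : 'M[A]_m) : 'rV[{poly A}]_m :=
  e0 m *m \adj (char_poly_mx Y).

Definition rdot (A : comNzRingType) m (Y : 'M[A]_m) (v : 'cV[A]_m) : {poly A} :=
  (rho Y *m map_mx polyC v) 0 0.

Lemma e0S (A : comNzRingType) m : e0 m.+1 = row_mx 1 0 :> 'rV[A]_(1 + m).
Proof.
apply/rowP => j; rewrite !mxE; case: splitP => i ->; rewrite !mxE.
  by rewrite !ord1.
by rewrite add1n.
Qed.

Lemma row_mx00 (T : Type) m (u : 'M[T]_1) (v : 'rV[T]_m) (i : 'I_1) :
  (row_mx u v : 'rV[_]_(1 + m)) i ord0 = u i i.
Proof. by rewrite mxE; case: splitP => j //= _; rewrite (ord1 i) (ord1 j). Qed.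

Lemma col_mx00 (T : Type) m (u : 'M[T]_1) (v : 'cV[T]_m) (i : 'I_1) :
  (col_mx u v : 'cV[_]_(1 + m)) ord0 i = u i i.
Proof. by rewrite mxE; case: splitP => j //= _; rewrite (ord1 i) (ord1 j). Qed.

Lemma usubmx00 (T : Type) m (c : 'cV[T]_m.+1) (i j : 'I_1) :
  @usubmx T 1 m 1 c i j = c ord0 ord0.
Proof.
by rewrite mxE; congr (c _ _); apply/val_inj; [case: i => -[]|case: j => -[]].
Qed.

Lemma map_e0 (A B : comNzRingType) (f : {rmorphism A -> B}) m :
  map_mx f (e0 m) = e0 m.
Proof. by apply/rowP => j; rewrite !mxE rmorph_nat. Qed.

Lemma e0_mulmx (A : comNzRingType) m (N : 'M[A]_m.+1) : (e0 m.+1 *m N) 0 0 = N 0 0.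
Proof.
rewrite mxE (bigD1 ord0) //= big1 => [|j j0]; last first.
  by rewrite [e0 _ _ _]mxE (negbTE (j0 : j != 0 :> nat)) mul0r.
by rewrite [e0 _ _ _]mxE /= mul1r addr0.
Qed.

Section Hessenberg.
Variable A : comNzRingType.
Implicit Types (tau a : A) (f g q : {poly A}).

Lemma rho_char_poly_mx m (Y : 'M[A]_m) :
  rho Y *m char_poly_mx Y = char_poly Y *: e0 m.
Proof. by rewrite /rho -mulmxA mul_adj_mx mul_mx_scalar. Qed.

Lemma char_poly_mx_hext m tau (Y : 'M[A]_m) b a :
  char_poly_mx (hext tau Y b a) =
  block_mx ('X - a%:P)%:M (- (tau%:P *: e0 m)) (- map_mx polyC b)
    (char_poly_mx Y) :> 'M[_]_(1 + m).
Proof.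
rewrite /char_poly_mx /hext -[m.+1]/(1 + m)%N map_block_mx (scalar_mx_block 1 m).
rewrite opp_block_mx add_block_mx !sub0r map_scalar_mx -raddfB /=.
by rewrite map_mxZ map_e0.
Qed.

(** As [rho Y] sends 'X - Y to [char_poly Y] times [e0], the entries to the right of the corner
    cancel. Multiplied by the adjugate, this identity yields both [char_poly_hext] and
    [rho_hext]. *)
Lemma rho_hext_char_poly_mx m tau (Y : 'M[A]_m) b a :
  (row_mx (char_poly Y)%:M (tau%:P *: rho Y) : 'rV[_]_(1 + m)) *m
    char_poly_mx (hext tau Y b a) =
  (('X - a%:P) * char_poly Y - tau%:P * rdot Y b)
    *: e0 m.+1.
Proof.
rewrite char_poly_mx_hext e0S.
have H := mul_row_block (char_poly Y)%:M (tau%:P *: rho Y)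
  ('X - a%:P)%:M (- (tau%:P *: e0 m)) (- map_mx polyC b) (char_poly_mx Y).
apply: (etrans H).
rewrite [RHS](scale_row_mx _ 1 0) scaler0.
rewrite -!scalemxAl rho_char_poly_mx; congr row_mx; last first.
  by rewrite mulmxN mul_scalar_mx scalerA scalerA mulrC addNr.
rewrite mulmxN scalerN -scalar_mxM mulrC scalemx1 raddfB /=; congr (_ - _).
by rewrite [LHS]mx11_scalar mxE -/(rdot _ _).
Qed.

Lemma adj00_hext m tau (Y : 'M[A]_m) b a :
  \adj (char_poly_mx (hext tau Y b a)) 0 0 = char_poly Y.
Proof.
rewrite mxE /cofactor addn0 expr0 mul1r row'_col'_char_poly_mx.
congr (\det (char_poly_mx _)).
apply/matrixP => i j; rewrite 2!mxE.
have l0 n (l : 'I_n) : lift (ord0 : 'I_n.+1) l = rshift 1 l by exact/val_inj.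
by rewrite !l0; exact: block_mxEdr.
Qed.

Lemma char_poly_hext m tau (Y : 'M[A]_m) b a :
  char_poly (hext tau Y b a) =
  ('X - a%:P) * char_poly Y - tau%:P * rdot Y b.
Proof.
have := rho_hext_char_poly_mx tau Y b a; set P := (_ - _) => h.
have /(congr1 (mulmx ^~ (\adj (char_poly_mx (hext tau Y b a))))) := h.
rewrite -mulmxA mul_mx_adj mul_mx_scalar -scalemxAl => /rowP/(_ 0).
rewrite [LHS]mxE [RHS]mxE e0_mulmx adj00_hext.
rewrite row_mx00 mxE mulr1n.
(* A monic polynomial is regular over any commutative ring, so this cancellation survives the zero
   divisors of k[t]/(t^(M+1)). *)
exact/(monic_rreg (char_poly_monic Y)).
Qed.

Lemma rho_hext m tau (Y : 'M[A]_m) b a :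
  rho (hext tau Y b a) = row_mx (char_poly Y)%:M (tau%:P *: rho Y)
    :> 'rV[_]_(1 + m).
Proof.
have /(congr1 (mulmx ^~ (\adj (char_poly_mx (hext tau Y b a))))) :=
  rho_hext_char_poly_mx tau Y b a.
rewrite -mulmxA mul_mx_adj mul_mx_scalar -scalemxAl -char_poly_hext.
move=> /rowP h; apply/esym/rowP => j.
have := h j; rewrite [LHS]mxE [RHS]mxE.
exact/(monic_lreg (char_poly_monic _)).
Qed.

Lemma rdotD m (Y : 'M[A]_m) u v : rdot Y (u + v) = rdot Y u + rdot Y v.
Proof. by rewrite /rdot map_mxD mulmxDr mxE. Qed.

Lemma rdotZ m (Y : 'M[A]_m) a v : rdot Y (a *: v) = a%:P * rdot Y v.
Proof. by rewrite /rdot map_mxZ -scalemxAr mxE. Qed.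

Lemma rdot0 m (Y : 'M[A]_m) : rdot Y 0 = 0.
Proof. by rewrite -(scale0r 0) rdotZ mul0r. Qed.

Lemma rdotN m (Y : 'M[A]_m) v : rdot Y (- v) = - rdot Y v.
Proof. by rewrite -scaleN1r rdotZ polyCN mulN1r. Qed.

(** Modulo [char_poly Y], the row [rho Y] is a left eigenvector of Y with eigenvalue 'X. *)
Lemma rdot_mulmx m (Y : 'M[A]_m) v :
  rdot Y (Y *m v) = 'X * rdot Y v - char_poly Y * ((e0 m *m v) 0 0)%:P.
Proof.
rewrite /rdot map_mxM.
have -> : rho Y *m (map_mx polyC Y *m map_mx polyC v) =
    'X *: (rho Y *m map_mx polyC v) - char_poly Y *: map_mx polyC (e0 m *m v).
  rewrite -[X in _ *m (X *m _)](subKr 'X%:M) -/(char_poly_mx Y) mulmxA mulmxBr.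
  rewrite rho_char_poly_mx mulmxBl -scalemxAl mul_mx_scalar -!scalemxAl.
  by rewrite map_mxM map_e0.
by rewrite [LHS]mxE [X in X + _]mxE [X in _ + X]mxE [X in - X]mxE
  [X in _ - _ * X]mxE.
Qed.

Lemma rdot_hext m tau (Y : 'M[A]_m) b a (c0 : 'M[_]_1) c1 :
  rdot (hext tau Y b a) (col_mx c0 c1) =
  (c0 0 0)%:P * char_poly Y + tau%:P * rdot Y c1.
Proof.
rewrite /rdot rho_hext -[m.+1]/(1 + m)%N map_col_mx.
have /matrixP/(_ 0 0) H := mul_row_col (char_poly Y)%:M (tau%:P *: rho Y)
  (map_mx polyC c0) (map_mx polyC c1).
rewrite [LHS]H mul_scalar_mx -scalemxAl mxE; congr (_ + _); last by rewrite mxE.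
by rewrite 2!mxE mulrC.
Qed.

(** Iterates [rdot_mulmx]: modulo [char_poly Y], the values of [rdot Y] are stable under
    multiplication by any polynomial, which makes [inJ tau Y] an ideal. *)
Lemma rdot_horner m (Y : 'M[A]_m.+1) q v : exists r,
  q * rdot Y v = rdot Y (horner_mx Y q *m v) + char_poly Y * r.
Proof.
elim/poly_ind: q v => [|q c IH] v.
  by exists 0; rewrite rmorph0 mul0mx rdot0 mul0r mulr0 addr0.
have [r hr] := IH (Y *m v).
exists (r + q * ((e0 m.+1 *m v) 0 0)%:P).
rewrite rmorphD rmorphM /= horner_mx_X horner_mx_C mulmxDl rdotD.
rewrite -[_ * Y]/(_ *m Y) -mulmxA mul_scalar_mx rdotZ.
move/(canLR (addrK _)): hr => <-; rewrite rdot_mulmx; ring.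
Qed.

Lemma char_poly_hextB m tau (Y : 'M[A]_m) b a b' a' :
  char_poly (hext tau Y b' a') - char_poly (hext tau Y b a) =
  (a - a')%:P * char_poly Y + tau%:P * rdot Y (b - b').
Proof. by rewrite !char_poly_hext rdotD rdotN polyCB; ring. Qed.

Lemma rdot_hext_char_poly m tau (Y : 'M[A]_m) b a :
  rdot (hext tau Y b a) (col_mx (1 : 'M[_]_1) 0) = char_poly Y.
Proof. by rewrite rdot_hext mxE rdot0 mulr0 addr0 mulr1n mul1r. Qed.

Lemma mulmx_hext m tau (Y : 'M[A]_m) b a (c0 : 'M[_]_1) c1 :
  hext tau Y b a *m col_mx c0 c1 =
  col_mx (a *: c0 + tau *: (e0 m *m c1)) (b *m c0 + Y *m c1).
Proof.
by have H := mul_block_col a%:M (tau *: e0 m) b Y c0 c1;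
  rewrite [LHS]H mul_scalar_mx -scalemxAl.
Qed.

(* The entries of powers of [hext tau Y b a] are polynomials in the corner
   entry a, and the corner one has the highest degree. *)
Lemma horner_hext_monic m tau (Y : 'M[A]_m) b s q : q \is monic ->
  size q = s.+1 -> exists (psi : {poly A}) (w : 'cV[{poly A}]_m),
  [/\ psi \is monic, size psi = s.+1, forall i, (size (w i 0%R) <= s)%N &
   forall a, horner_mx (hext tau Y b a) q *m col_mx (1 : 'M[_]_1) 0 =
     col_mx (psi.[a])%:M (map_mx (horner^~ a) w)].
Proof.
elim: s q => [|s IH] q qm qs.
  exists 1, 0; split; rewrite ?monic1 ?size_poly1//.
    by move=> i; rewrite mxE size_poly0.
  move=> a.
  have qC := size1_polyC (eq_leq qs).
  have -> : q = 1 by move: qm; rewrite qC monicE lead_coefC => /eqP->.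
  rewrite rmorph1 mul1mx hornerC; apply: (congr1 (@col_mx A 1 m 1 _)).
  by apply/matrixP => i j; rewrite !mxE horner0.
move: qm qs; elim/poly_ind: q => [|q c _]; first by rewrite size_poly0.
rewrite size_MXaddC; case: ifP => // _ qm [qs].
have q0 : q != 0 by rewrite -size_poly_gt0 qs.
have {}qm : q \is monic.
  move: qm; rewrite !monicE lead_coefDl ?lead_coefMX//.
  by rewrite size_mulX// qs size_polyC; case: (c != 0).
have [psi [w [psim psis ws H]]] := IH q qm qs.
have es : (size (\sum_i e0 m 0 i *: w i 0)%R <= s)%N.
  apply: (leq_trans (size_sum _ _ _)); apply/bigmax_leqP => i _.
  exact: leq_trans (size_scale_leq _ _) (ws i).
pose r := tau *: (\sum_i e0 m 0 i *: w i 0) + c%:P.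
have rs : (size r <= s.+1)%N.
  rewrite (leq_trans (size_polyD _ _))// geq_max (leq_trans (size_scale_leq _ _)) ?(leq_trans es)//.
  by rewrite (leq_trans (size_polyC_leq1 _)).
exists (psi * 'X + r), (\col_i (b i 0 *: psi + \sum_j Y i j *: w j 0)).
have psX : size (psi * 'X) = s.+2 by rewrite size_mulX ?psis// monic_neq0.
split.
- by rewrite monicE lead_coefDl ?psX// lead_coefMX -monicE.
- by rewrite size_polyDl ?psX.
- move=> i; rewrite mxE (leq_trans (size_polyD _ _))// geq_max.
  rewrite (leq_trans (size_scale_leq _ _)) ?psis//.
  rewrite (leq_trans (size_sum _ _ _))//; apply/bigmax_leqP => j _.
  by rewrite (leq_trans (size_scale_leq _ _))// (leq_trans (ws j)).
move=> a; rewrite rmorphD rmorphM /= horner_mx_X horner_mx_C mulmxDl.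
rewrite -[_ * hext _ _ _ _]/(_ *m hext _ _ _ _).
have -> : horner_mx (hext tau Y b a) q *m hext tau Y b a =
    hext tau Y b a *m horner_mx (hext tau Y b a) q.
  by apply: comm_mx_sym; exact/comm_mx_horner/comm_mx_refl.
have Z : c *: col_mx (1 : 'M[A]_1) (0 : 'cV[_]_m) = col_mx c%:M 0.
  by rewrite scale_col_mx scaler0 scalemx1.
rewrite -mulmxA H mulmx_hext mul_scalar_mx [X in _ + X]Z.
have Z2 (u u' : 'M[A]_1) (v v' : 'cV[A]_m) :
    (col_mx u v : 'cV[_]_m.+1) + col_mx u' v' = col_mx (u + u') (v + v').
  exact: (@add_col_mx A 1 m 1).
rewrite [LHS]Z2 addr0.
apply: (congr2 (@col_mx A 1 m 1)).
  apply/matrixP => i j; rewrite !ord1 !mxE !mulr1n hornerD hornerMX hornerD.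
  rewrite hornerZ horner_sum hornerC addrA mulrC; congr (_ + _ * _ + _).
  by apply: eq_bigr => l _; rewrite hornerZ !mxE.
apply/matrixP => i j; rewrite !ord1 !mxE hornerD hornerZ horner_sum big_ord1 !mxE mulr1n.
by congr (_ + _); apply: eq_bigr => l _; rewrite hornerZ !mxE.
Qed.
End Hessenberg.

(* The ideal generated by char_poly Y and the tau%:P * (rho Y) 0 i: it contains
   char_poly (hext tau Y b a) for all b and a, see char_poly_hext. *)
Definition inJ (A : comNzRingType) m (tau : A) (Y : 'M[A]_m) (f : {poly A}) :=
  exists c q, f = tau%:P * rdot Y c + char_poly Y * q.

(** [ds] lists the exponents from the outermost border inwards. The last one multiplies an empty
    row, so that [ds] has as many entries as the matrix has rows. *)
Inductive hess (A : comNzRingType) (t : A) (D : nat) :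
    forall m, seq nat -> 'M[A]_m -> Prop :=
| Hess0 Y : @hess A t D 0 [::] Y
| HessS m ds (Y : 'M[A]_m) d b a : (d <= D)%N -> @hess A t D m ds Y ->
    @hess A t D m.+1 (d :: ds) (hext (t ^+ d) Y b a).

Section Chain.
Variables (A : comNzRingType) (t : A) (D : nat).
Implicit Types (tau a : A) (f g q : {poly A}).

Lemma rdot_horner_ex m (Y : 'M[A]_m) q v : exists u r,
  q * rdot Y v = rdot Y u + char_poly Y * r.
Proof.
case: m Y v => [|m] Y v; last first.
  by have [r] := rdot_horner Y q v; eexists; exists r; eassumption.
exists 0, 0; rewrite rdot0 mulr0 addr0 (_ : v = 0) ?rdot0 ?mulr0//.
by apply/colP => -[].
Qed.

(** By [rdot_hext] and [char_poly_hext], the generators for the extension are combinations of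
    [char_poly Y] and of tau times values of [rdot Y]. *)
Lemma inJ_hext m tau tau' (Y : 'M[A]_m) b a f :
  inJ tau' (hext tau Y b a) f -> inJ tau Y f.
Proof.
move=> [c [q ->]]; have [u [r hr]] := rdot_horner_ex Y q b.
rewrite -[c](@vsubmxK A 1 m) rdot_hext char_poly_hext.
set c0 := @usubmx A 1 m 1 c; set c1 := @dsubmx A 1 m 1 c.
exists (tau' *: c1 - u), (tau'%:P * (c0 0 0)%:P + ('X - a%:P) * q - tau%:P * r).
rewrite rdotD rdotN rdotZ mulrBl -[tau%:P * _ * q]mulrA [rdot Y b * q]mulrC hr.
by ring.
Qed.

(** For the extension, [tau%:P * rdot Y c] is the pairing with (0, c) and [char_poly Y] the pairing
    with (1, 0); the factor q moves inside through [rdot_horner]. *)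
Lemma inJ_step m tau (Y : 'M[A]_m) b a c q : exists r,
  tau%:P * rdot Y c + char_poly Y * q =
  rdot (hext tau Y b a)
    (col_mx (0 : 'M[_]_1) c + horner_mx (hext tau Y b a) q *m col_mx (1 : 'M[_]_1) 0)
  + char_poly (hext tau Y b a) * r.
Proof.
have [r] := rdot_horner (hext tau Y b a) q (col_mx (1 : 'M[_]_1) 0).
rewrite rdot_hext_char_poly => hr; exists r.
by rewrite rdotD -addrA -hr rdot_hext mxE polyC0 mul0r add0r [q * _]mulrC.
Qed.

(** Across one more border, an element of the ideal becomes a value of [rdot] modulo the new
    characteristic polynomial ([inJ_step]), so a further factor t^d' puts it in the next ideal. This
    absorbs the truncation errors in [inJ_lift]. *)
Lemma inJ_pow m ds (Y : 'M[A]_m) d g :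
  hess t D ds Y -> inJ (t ^+ d) Y ((t ^+ (d + sumn ds))%:P * g).
Proof.
move=> h; elim: h d g => [{}Y|{}m {}ds {}Y d b a _ _ IH] d' g.
  exists 0, ((t ^+ (d' + 0))%:P * g).
  by rewrite rdot0 mulr0 add0r [char_poly Y]det_mx00 mul1r.
have [c [q]] := IH d g; have [r hr] := inJ_step (t ^+ d) Y b a c q.
rewrite hr => hg; rewrite exprD polyCM -mulrA hg.
by eexists; exists ((t ^+ d')%:P * r); rewrite mulrDr mulrCA.
Qed.

Lemma size_rdot m ds (Y : 'M[A]_m) c :
  hess t D ds Y -> (size (rdot Y c) <= m)%N.
Proof.
move=> h; elim: h c => [{}Y|{}m {}ds {}Y d b a _ _ IH] c.
  by rewrite (_ : c = 0) ?rdot0 ?size_poly0//; apply/colP => -[].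
rewrite -[c](@vsubmxK A 1 m) rdot_hext !mul_polyC.
rewrite (leq_trans (size_polyD _ _))// geq_max.
rewrite !(leq_trans (size_scale_leq _ _))// ?size_char_poly//.
exact: leq_trans (IH _) _.
Qed.

Lemma size_rdot_hext m ds tau (Y : 'M[A]_m) b a c :
  hess t D ds Y -> (size (rdot (hext tau Y b a) c) <= m.+1)%N.
Proof.
move=> h; rewrite -[c](@vsubmxK A 1 m) rdot_hext !mul_polyC.
rewrite (leq_trans (size_polyD _ _))// geq_max.
rewrite !(leq_trans (size_scale_leq _ _))// ?size_char_poly//.
exact: leq_trans (size_rdot _ h) _.
Qed.

(** [char_poly Y] is monic of degree m and the values of [rdot Y] have smaller degree, so only the
    first entry of c contributes in degree m. *)
Lemma coef_rdot_hext m ds tau (Y : 'M[A]_m) b a c :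
  hess t D ds Y -> (rdot (hext tau Y b a) c)`_m = c 0 0.
Proof.
move=> h; rewrite -{1}[c](@vsubmxK A 1 m) rdot_hext !mul_polyC coefD !coefZ.
rewrite [X in _ + _ * X]nth_default ?(size_rdot _ h)// mulr0 addr0.
have := char_poly_monic Y; rewrite monicE lead_coefE size_char_poly => /eqP ->.
by rewrite mulr1 mxE; congr (c _ _); exact/val_inj.
Qed.

(* Comparing top coefficients: the coordinates of f along the [rho] of the
   extended matrix have a first entry that is monic in the corner a. *)
Lemma inJ_hext_dvd m ds tau (Y : 'M[A]_m) b f n :
  hess t D ds Y -> f \is monic -> size f = n.+1 -> (m <= n)%N -> inJ tau Y f ->
  exists psi : {poly A}, [/\ psi \is monic, size psi = (n - m).+1 &
    forall a tau', inJ tau' (hext tau Y b a) f -> exists u, psi.[a] = tau' * u].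
Proof.
move=> h fm fs mn [c [q fE]].
have sr : (size (tau%:P * rdot Y c)%R <= m)%N.
  by rewrite mul_polyC (leq_trans (size_scale_leq _ _)) ?(size_rdot _ h).
have sq : size (char_poly Y * q) = n.+1.
  have [sl|sl] := leqP (size (char_poly Y * q)%R) m; last first.
    by rewrite -fs fE addrC size_polyDl// (leq_ltn_trans sr).
  have : (size f <= m)%N by rewrite fE (leq_trans (size_polyD _ _))// geq_max sr.
  by rewrite fs ltnNge mn.
have q0 : q != 0 by apply: contra_eq_neq sq => ->; rewrite mulr0 size_poly0.
have sqE : size q = (n - m).+1.
  by move: sq; rewrite size_monicM ?char_poly_monic// size_char_poly; lia.
have qm : q \is monic.
  move: fm; rewrite !monicE fE addrC lead_coefDl ?sq ?ltnS ?(leq_trans sr)//.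
  by rewrite lead_coef_monicM ?char_poly_monic.
have [psi [w [psim psis _ H]]] := horner_hext_monic tau Y b qm sqE.
exists psi; split => // a tau' [c' [q' fE']].
have [r] := inJ_step tau Y b a c q; rewrite -fE H fE'.
set c2 := (_ + _ : 'cV[_]_m.+1) => E.
(* The two pairings agree modulo the characteristic polynomial of the extension, which is monic of
   degree m.+1, and both have degree at most m; hence they are equal. *)
have /(congr1 (fun p : {poly A} => p`_m)) : tau'%:P * rdot (hext tau Y b a) c' =
    rdot (hext tau Y b a) c2 :> {poly A}.
  apply/eqP; rewrite -subr_eq0; apply/eqP.
  have : tau'%:P * rdot (hext tau Y b a) c' - rdot (hext tau Y b a) c2 =
      char_poly (hext tau Y b a) * (r - q').
    by rewrite mulrBr; move/(canRL (addrK _)): E => ->; ring.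
  move=> E2; have [rq|rq] := eqVneq (r - q') 0; first by rewrite E2 rq mulr0.
  have := size_monicM (char_poly_monic (hext tau Y b a)) rq.
  rewrite -E2 size_char_poly => E3.
  have : (size (tau'%:P * rdot (hext tau Y b a) c' -
               rdot (hext tau Y b a) c2)%R <= m.+1)%N.
    rewrite (leq_trans (size_polyD _ _))// size_polyN geq_max mul_polyC.
    by rewrite (leq_trans (size_scale_leq _ _)) (size_rdot_hext _ _ _ _ h).
  by rewrite E3; move: rq; rewrite -size_poly_gt0; lia.
rewrite mul_polyC coefZ !(coef_rdot_hext _ _ _ _ h) => {}E.
exists (c' 0 0); rewrite E.
by rewrite /c2 mxE !col_mx00 !mxE mulr1n add0r.
Qed.
End Chain.

(** * Counting over the truncated ring k[t]/(t^(M+1)) *)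

Section TruncatedRing.
Variables (k : finFieldType) (M : nat).
Local Notation Q := {poly %/ ('X^(M.+1) : {poly k})}.
Local Notation q := #|k|.
Implicit Types (x y : Q) (p : {poly k}).

Definition qt : Q := in_qpoly 'X^(M.+1) 'X.

Lemma mk_monicXn : mk_monic ('X^(M.+1) : {poly k}) = 'X^(M.+1).
Proof. exact: mk_monic_Xn. Qed.

Lemma size_mk_monicXn : size (mk_monic ('X^(M.+1) : {poly k})) = M.+2.
Proof. by rewrite mk_monicXn size_polyXn. Qed.

Lemma size_lift x : (size (val x) <= M.+1)%N.
Proof. by have := size_mk_monic x; rewrite [X in (_ < X)%N]size_mk_monicXn. Qed.

Lemma in_qpolyK p : (size p <= M.+1)%N -> val (in_qpoly 'X^(M.+1) p) = p.
Proof. by move=> sp; apply: in_qpoly_small; rewrite size_mk_monicXn. Qed.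

Lemma liftK x : in_qpoly 'X^(M.+1) (val x) = x.
Proof. by apply/val_inj/in_qpolyK/size_lift. Qed.

Lemma liftB x y : val (x - y) = val x - val y.
Proof. exact: raddfB. Qed.

Lemma lift_qt d : (d <= M)%N -> val (qt ^+ d) = 'X^d.
Proof. by move=> dM; rewrite -rmorphXn; apply: in_qpolyK; rewrite size_polyXn. Qed.

Lemma in_qpoly_eq0 p : (in_qpoly 'X^(M.+1) p == 0) = ('X^(M.+1) %| p).
Proof.
by rewrite -val_eqE /= [X in Pdiv.Ring.rmodp _ X]mk_monicXn dvdpE /Pdiv.Ring.rdvdp.
Qed.

Lemma qt_mul_eq0 d x : (qt ^+ d * x == 0) = ('X^(M.+1) %| 'X^d * val x).
Proof. by rewrite -in_qpoly_eq0 rmorphM rmorphXn /= liftK. Qed.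

Lemma card_dvd_lift s : (#|[set x : Q | ('X^s %| val x)%R]| <= q ^ (M.+1 - s))%N.
Proof.
pose F x : {poly_(M.+1 - s) k} := npolyp _ (val x %/ 'X^s).
rewrite -(card_npoly k (M.+1 - s)) -(card_in_imset (f := F)) ?max_card//.
move=> x y; rewrite !inE => sx sy /(congr1 val) /=.
have sz (z : Q) : (size (val z %/ 'X^s)%R <= M.+1 - s)%N.
  by rewrite size_divp -?size_poly_gt0 ?size_polyXn// leq_sub2r ?size_lift.
rewrite !npolypK// => /(congr1 (fun p => p * 'X^s)).
by rewrite !divpK// => /val_inj.
Qed.

Lemma card_qt_ann d : (#|[set x : Q | (qt ^+ d * x == 0)%R]| <= q ^ d)%N.
Proof.
have [dM|Md] := leqP d M.+1; last first.
  rewrite (leq_trans (max_card _))// card_qpoly mk_monicXn size_polyXn.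
  by rewrite leq_exp2l ?(ltnW Md)// card_finNzRing_gt1.
rewrite -{2}(subKn dM) (leq_trans _ (card_dvd_lift _))// subset_leq_card//.
apply/fintype.subsetP => x; rewrite !inE qt_mul_eq0 -{1}(subnKC dM) exprD.
by rewrite dvdp_mul2l// -size_poly_gt0 size_polyXn.
Qed.

Lemma card_dvd_lift_col m s :
  (#|[set u : 'rV[Q]_m | [forall i, ('X^s %| val (u 0 i))%R]]| <= q ^ ((M.+1 - s) * m))%N.
Proof.
rewrite expnM.
pose S := [set x : Q | ('X^s %| val x)%R].
rewrite -[X in (_ <= _ ^ X)%N](card_ord m).
pose F (u : 'rV[Q]_m) : {ffun 'I_m -> Q} := [ffun i => u 0 i].
have Fi : injective F.
  by move=> u v /ffunP uv; apply/rowP => i; have := uv i; rewrite !ffunE.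
apply: (@leq_trans (#|S| ^ #|'I_m|)); last first.
  by case: #|'I_m| => // l; rewrite leq_exp2r// card_dvd_lift.
rewrite -card_ffun_on -(card_imset _ Fi) subset_leq_card//.
apply/fintype.subsetP => g /imsetP[u]; rewrite inE => /forallP uS ->.
by apply/ffun_onP => i; rewrite ffunE inE.
Qed.

Lemma unit_lift x : ~~ ('X %| val x) -> x \is a GRing.unit.
Proof.
have cX p : ~~ ('X %| p) -> coprimep 'X p.
  rewrite -[X in X %| _]subr0 -[X in coprimep X _]subr0 -polyC0.
  by rewrite coprimep_sym dvdp_XsubCl coprimep_XsubC.
move=> /cX Xx; have cop : coprimep (mk_monic 'X^(M.+1)) (val x).
  by rewrite [X in coprimep X _]mk_monicXn coprimep_expl.
by apply/unitrP; exists (qpoly_inv x); split;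
  [exact: qpoly_mulVz | exact: qpoly_mulzV].
Qed.
End TruncatedRing.

(** Let j be the exact multiplicity of 'X in u: either j is at least s, or v is divisible by the
    remaining factors, at least a - s in number. *)
Lemma dvdp_Xn_mul (k : fieldType) (u v : {poly k}) a s :
  'X^a %| u * v -> 'X^s %| u \/ 'X^(a - s) %| v.
Proof.
have [->|u0] := eqVneq u 0; first by left; rewrite dvdp0.
have [j [u']] := multiplicity_XsubC u 0; rewrite u0 /= subr0 => u'0 ->.
have [sj|js] := leqP s j; first by left; rewrite dvdp_mull// dvdp_exp2l.
have [ja|aj] := leqP j a; last by right; rewrite (_ : (a - s = 0)%N) ?dvd1p//; lia.
rewrite mulrAC -{1}(subnK ja) exprD dvdp_mul2r; last first.
  by rewrite -size_poly_gt0 size_polyXn.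
rewrite Gauss_dvdpr => [|]; last first.
  by rewrite coprimep_expl// -['X]subr0 -polyC0 coprimep_sym coprimep_XsubC.
by move=> /(dvdp_trans _) h; right; apply: h; rewrite dvdp_exp2l; lia.
Qed.

Section Sublevel.
Variables (k : finFieldType) (M : nat).
Local Notation Q := {poly %/ ('X^(M.+1) : {poly k})}.
Local Notation q := #|k|.

(* Write psi - psi.[x0] = phi * ('X - x0) for a point x0 of the set: every point
   of the set is close to x0 or in a sublevel set of phi. *)
Lemma card_sublevel (psi : {poly {poly k}}) r a s : psi \is monic ->
  size psi = r.+1 -> (r * s < a)%N ->
  (#|[set x : Q | ('X^a %| psi.[val x])%R]| <= r * q ^ (M.+1 - s))%N.
Proof.
elim: r psi a => [|r IH] psi a psim psis ra.
  rewrite mul0n leqn0 cards_eq0; apply/eqP/finset.setP => x; rewrite !inE.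
  have psiC := size1_polyC (eq_leq psis); apply/negP.
  have -> : psi = 1 by move: psim; rewrite psiC monicE lead_coefC => /eqP->.
  by rewrite hornerC => /dvdp_leq; rewrite oner_eq0 size_polyXn size_poly1; lia.
set S := [set x : Q | _].
have [->|/finset.set0Pn[x0]] := eqVneq S finset.set0; first by rewrite cards0.
rewrite inE => x0S.
have /factor_theorem[phi phiE] : root (psi - psi.[val x0]%:P) (val x0).
  by rewrite rootE hornerD hornerN hornerC subrr.
have E0 : psi = phi * ('X - (val x0)%:P) + psi.[val x0]%:P by rewrite -phiE subrK.
have sphi : size (phi * ('X - (val x0)%:P)) = r.+2.
  rewrite -phiE size_polyDl// size_polyN psis.
  exact: leq_ltn_trans (size_polyC_leq1 _) _.
have phi0 : phi != 0 by apply: contra_eq_neq sphi => ->; rewrite mul0r size_poly0.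
have phis : size phi = r.+1.
  by move: sphi; rewrite size_Mmonic ?monicXsubC// size_XsubC; lia.
have phim : phi \is monic.
  move: psim; rewrite !monicE E0 lead_coefDl ?sphi; last first.
    exact: leq_ltn_trans (size_polyC_leq1 _) _.
  by rewrite lead_coef_Mmonic ?monicXsubC.
(* For x in S, 'X^a divides (x - x0) * phi(x), so [dvdp_Xn_mul] places x in one of these two sets.
   T1 is a coset of the multiples of t^s; T2 falls under the induction hypothesis, as r * s < a -
   s. *)
pose T1 := [set y + x0 | y in [set y : Q | ('X^s %| val y)%R]].
pose T2 := [set x : Q | ('X^(a - s) %| phi.[val x])%R].
have /subset_leq_card/leq_trans : S \subset T1 :|: T2.
  apply/fintype.subsetP => x; rewrite !inE => xS.
  have : 'X^a %| (val x - val x0) * phi.[val x].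
    rewrite -(dvdp_addl _ x0S) [X in _ %| _ + X]/= mulrC.
    suff -> : phi.[val x] * (val x - val x0) + psi.[val x0] = psi.[val x] by [].
    by rewrite {2}E0 hornerD hornerM hornerXsubC hornerC.
  move=> /dvdp_Xn_mul-/(_ s)[xx0|->]; last by rewrite orbT.
  apply/orP; left; apply/imsetP; exists (x - x0); last by rewrite subrK.
  by rewrite inE liftB.
move=> le; apply: le; rewrite (leq_trans (leq_card_setU _ _))// mulSn leq_add//.
  by rewrite (leq_trans (leq_imset_card _ _))// card_dvd_lift.
by apply: IH => //; lia.
Qed.
End Sublevel.

(* Bringing the first row to the form [a, t^d, 0, ..., 0] costs a factor
   q ^ (- d * size ds'), so that a matrix reduced to Hessenberg form with
   exponents ds gets the weight q ^ (- wt ds). *)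
Fixpoint wt (ds : seq nat) : nat :=
  if ds is d :: ds' then (d * size ds' + wt ds')%N else 0%N.

Section Fiber.
Variables (k : finFieldType) (M D : nat).
Local Notation Q := {poly %/ ('X^(M.+1) : {poly k})}.
Local Notation q := #|k|.
Local Notation t := (qt k M).

Lemma hess_size (A : comNzRingType) (u : A) m ds (Y : 'M[A]_m) :
  hess u D ds Y -> size ds = m.
Proof. by elim=> // {}m {}ds {}Y d b a _ _ /= ->. Qed.

(** The top coefficient forces t^e to kill the first entry of b, which leaves at most q^e values;
    the remaining entries are then in the kernel for the smaller matrix with exponent e + d. The
    exponents add up to the recursion of [wt]. *)
Lemma card_rdot_ann m ds (Y : 'M[Q]_m) e : hess t D ds Y ->
  (#|[set b : 'cV[Q]_m | ((t ^+ e)%:P * rdot Y b == 0)%R]| <= q ^ (e * m + wt ds))%N.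
Proof.
move=> h; elim: h e => [{}Y|{}m {}ds {}Y d b a _ h IH] e.
  by rewrite muln0 (leq_trans (max_card _))// card_mx.
pose S0 := [set x : Q | t ^+ e * x == 0].
pose S1 := [set c : 'cV[Q]_m | (t ^+ (e + d))%:P * rdot Y c == 0].
pose F (c : 'cV[Q]_m.+1) := (c 0 0, @dsubmx Q 1 m 1 c).
have Fi : injective F.
  move=> c c' [c0 c1]; rewrite -[c](@vsubmxK Q 1 m 1) -[c'](@vsubmxK Q 1 m 1) c1.
  apply: (congr1 (fun u : 'M[_]_1 => @col_mx Q 1 m 1 u _)).
  by apply/matrixP => i j; rewrite !usubmx00.
rewrite -(card_imset _ Fi) (@leq_trans #|finset.setX S0 S1|)//; last first.
  rewrite cardsX (leq_trans (leq_mul (card_qt_ann _ _ e) (IH _)))// -expnD.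
  by rewrite leq_exp2l ?card_finNzRing_gt1//= (hess_size h); lia.
rewrite subset_leq_card//; apply/fintype.subsetP => _ /imsetP[c + ->].
rewrite !inE /= => /eqP ce.
have c0 : t ^+ e * c 0 0 = 0.
  have := congr1 (fun p : {poly Q} => p`_m) ce.
  by rewrite mul_polyC coefZ (coef_rdot_hext _ _ _ _ h) coef0.
rewrite c0 eqxx /=; apply/eqP; move: ce.
rewrite -{1}[c](@vsubmxK Q 1 m 1) rdot_hext.
rewrite mulrDr mulrA -polyCM usubmx00.
by rewrite c0 mul0r add0r mulrA -polyCM -exprD.
Qed.

(** Two borders with the same characteristic polynomial have the same corner, by the coefficient of
    degree m, and their columns differ by a vector in the kernel of t^d [rdot Y]. So [card_rdot_ann]
    with e = d gives the bound. *)
Lemma card_char_poly_hext m ds (Y : 'M[Q]_m) d (p : {poly Q}) : hess t D ds Y ->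
  (#|[set ba : 'cV[Q]_m * Q |
     (char_poly (hext (t ^+ d) Y ba.1 ba.2) == p)%R]| <= q ^ wt (d :: ds))%N.
Proof.
move=> h; set S := [set ba | _].
have [->|/finset.set0Pn[[b0 a0] p0]] := eqVneq S finset.set0; first by rewrite cards0.
move: p0; rewrite inE /= => /eqP p0.
pose F (ba : 'cV[Q]_m * Q) := ba.1 - b0.
have H b a : (b, a) \in S -> a = a0 /\ (t ^+ d)%:P * rdot Y (b - b0) = 0.
  rewrite inE /= -p0 => /eqP E.
  have {}E : (a - a0)%:P * char_poly Y + (t ^+ d)%:P * rdot Y (b - b0) = 0.
    by rewrite -char_poly_hextB E subrr.
  have aa : a = a0.
    have := congr1 (fun p : {poly Q} => p`_m) E.
    rewrite !mul_polyC coefD !coefZ coef0 [X in _ + _ * X]nth_default ?(size_rdot _ h)//.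
    have := char_poly_monic Y; rewrite monicE lead_coefE size_char_poly => /eqP ->.
    by rewrite mulr0 addr0 mulr1 => /eqP; rewrite subr_eq0 => /eqP.
  by move: E; rewrite aa subrr mul0r add0r.
rewrite -(@card_in_imset _ _ F) => [|[b a] [b' a'] /H[-> _] /H[-> _]]; last first.
  by move=> /addIr/= ->.
rewrite /= (hess_size h) (leq_trans _ (card_rdot_ann d h))// subset_leq_card//.
by apply/fintype.subsetP => _ /imsetP[[b a] /H[_ E] ->]; rewrite inE E.
Qed.
End Fiber.

(** * Averages over matrices and Hessenberg reduction *)

Definition avg (T : finType) (F : T -> rat) : rat := (\sum_x F x) / #|T|%:R.

Section Avg.
Implicit Types T : finType.

Lemma eq_avg T (F G : T -> rat) : F =1 G -> avg F = avg G.
Proof. by move=> FG; rewrite /avg (eq_bigr _ (fun x _ => FG x)). Qed.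

Lemma ler_avg T (F G : T -> rat) : (forall x, F x <= G x) -> avg F <= avg G.
Proof. by move=> FG; rewrite ler_wpM2r ?invr_ge0// ler_sum. Qed.

Lemma avg_ge0 T (F : T -> rat) : (forall x, 0 <= F x) -> 0 <= avg F.
Proof. by move=> F0; rewrite mulr_ge0 ?invr_ge0// sumr_ge0. Qed.

Lemma avg_le_cst T (F : T -> rat) c : 0 <= c -> (forall x, F x <= c) -> avg F <= c.
Proof.
move=> c0 Fc; rewrite /avg; have [T0|T0] := posnP #|T|; first by rewrite T0 invr0 mulr0.
by rewrite ler_pdivrMr ?ltr0n// mulr_natr -sumr_const ler_sum.
Qed.

Lemma avgZ T c (F : T -> rat) : avg (fun x => c * F x) = c * avg F.
Proof. by rewrite /avg -mulr_sumr mulrA. Qed.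

Lemma avg_sum T (I : Type) (r : seq I) (P : pred I) (F : I -> T -> rat) :
  avg (fun x => \sum_(i <- r | P i) F i x) = \sum_(i <- r | P i) avg (F i).
Proof. by rewrite /avg exchange_big mulr_suml. Qed.

Lemma avgD T (F G : T -> rat) : avg (fun x => F x + G x) = avg F + avg G.
Proof. by rewrite /avg big_split mulrDl. Qed.

Lemma avg_bij T T' (h : T -> T') (F : T' -> rat) : bijective h ->
  avg F = avg (fun x => F (h x)).
Proof.
by move=> hb; rewrite /avg (bij_eq_card hb) (reindex h)//; exact: onW_bij.
Qed.

Lemma avg_pair T T' (F : T * T' -> rat) :
  avg F = avg (fun x => avg (fun y => F (x, y))).
Proof.
rewrite /avg card_prod natrM invfM mulrA -mulr_suml mulrAC; congr (_ / _ / _).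
by rewrite pair_bigA; apply: eq_bigr => -[].
Qed.

Lemma avg_bool T (P : pred T) : avg (fun x => (P x)%:R) = #|[set x | P x]|%:R / #|T|%:R.
Proof.
rewrite /avg -sum1dep_card natr_sum [in RHS]big_mkcond; congr (_ / _).
by apply: eq_bigr => x _; case: (P x).
Qed.
End Avg.

Section Reduction.
Variables (k : finFieldType) (M : nat).
Local Notation Q := {poly %/ ('X^(M.+1) : {poly k})}.
Local Notation q := #|k|.
Local Notation t := (qt k M).

(** The identity matrix with row i replaced by u is invertible, and a transposition moves that row
    to the top. *)
Lemma unit_row_extend m (u : 'rV[Q]_m.+1) i : u 0 i \is a GRing.unit ->
  exists2 G : 'M[Q]_m.+1, G \in unitmx & u = e0 m.+1 *m G.
Proof.
move=> ui; pose c : 'cV[Q]_m.+1 := delta_mx i 0.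
have [r rE] : exists r : 'rV[Q]_m.+1, r = u - delta_mx 0 i by eexists.
have rc : r *m c = (u 0 i - 1)%:M.
  rewrite [LHS]mx11_scalar; congr _%:M.
  rewrite rE -colE mxE [X in X = _]mxE [X in _ + X]mxE; congr (_ - _).
  by rewrite mxE !eqxx.
pose E : 'M[_]_m.+1 := 1%:M + c *m r.
(* Inverse of a rank one update: [r *m c] is u_i - 1, so the denominator 1 + [r *m c] is the unit
   u_i. *)
pose E' : 'M[_]_m.+1 := 1%:M - (u 0 i)^-1 *: (c *m r).
have EU : E \in unitmx.
  apply: (proj1 (mulmx1_unit (B := E') _)).
  rewrite /E /E' mulmxDl mul1mx mulmxBr mulmx1 -scalemxAr.
  rewrite mulmxA -(mulmxA c) rc mul_mx_scalar -scalemxAl scalerA.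
  rewrite -addrA [X in _ + X](_ : _ = 0) ?addr0//.
  rewrite mulrBr mulVr// mulr1 scalerBl scale1r; set X := c *m r.
  by rewrite opprB [X + _]addrC subrK addNr.
exists (perm_mx (tperm 0 i) *m E); first by rewrite unitmx_mul unitmx_perm.
have -> : e0 m.+1 = delta_mx 0 0 :> 'rV[Q]_m.+1.
  by apply/rowP => j; rewrite !mxE eqxx.
rewrite -row_permE -rowE.
have -> : row 0 (row_perm (tperm 0 i) E) = row i E.
  by apply/rowP => j; rewrite [LHS]mxE [LHS]mxE tpermL [RHS]mxE.
rewrite rowE mulmxDr mulmx1 mulmxA mul_delta_mx.
have -> : delta_mx 0 0 = 1 :> 'M[Q]_1.
  by apply/matrixP => j l; rewrite !mxE !ord1 eqxx.
by rewrite mul1mx rE addrC subrK.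
Qed.

(** The exponent d is the largest one, at most M.+1, such that t^d divides w. If d < M.+1, the
    quotient of w by t^d has an entry prime to t, hence a unit, and [unit_row_extend] applies;
    otherwise w = 0. *)
Lemma row_orbit m (w : 'rV[Q]_m.+1) : exists d (G : 'M[Q]_m.+1),
  [/\ (d <= M.+1)%N, G \in unitmx, forall i, 'X^d %| val (w 0 i) &
      w = (t ^+ d *: e0 m.+1) *m G].
Proof.
pose P d := (d <= M.+1)%N && [forall i, 'X^d %| val (w 0 i)].
have P0 : exists d, P d by exists 0%N; apply/andP; split=> //; apply/forallP => i; rewrite dvd1p.
have PM d : P d -> (d <= M.+1)%N by case/andP.
case: (ex_maxnP P0 PM) => d /andP[dM /forallP wd] dmax.
have [dM1|dM1] := eqVneq d M.+1.
  exists d, 1%:M; split; rewrite ?unitmx1// mulmx1.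
  have w0 i : w 0 i = 0.
    by apply/eqP; rewrite -[w 0 i]liftK in_qpoly_eq0; move: (wd i); rewrite [in 'X^d]dM1.
  suff -> : t ^+ d = 0 by rewrite scale0r; apply/rowP => i; rewrite w0 mxE.
  by apply/eqP; rewrite dM1 -[t ^+ _]mulr1 qt_mul_eq0 dvdp_mulr.
have {}dM : (d < M.+1)%N by rewrite ltn_neqAle dM1.
have [i wi] : exists i, ~~ ('X^(d.+1) %| val (w 0 i)).
  apply/existsP; rewrite -negb_forall; apply/negP => wd'.
  by have := dmax d.+1; rewrite /P dM wd' ltnn => /(_ isT).
pose v j := val (w 0 j) %/ 'X^d.
have vE j : val (w 0 j) = v j * 'X^d by rewrite divpK.
pose u : 'rV[Q]_m.+1 := \row_j in_qpoly 'X^(M.+1) (v j).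
have wu : w = t ^+ d *: u.
  apply/rowP => j; rewrite !mxE -[LHS]liftK vE rmorphM rmorphXn /= mulrC.
  by [].
have [|G GU uG] := unit_row_extend (u := u) (i := i).
  apply: unit_lift; rewrite mxE in_qpolyK; last first.
    by rewrite /v size_divp -?size_poly_gt0 ?size_polyXn// (leq_trans (leq_subr _ _)) ?size_lift.
  apply: contra wi; rewrite vE exprS => vX; exact: dvdp_mul.
by exists d, G; split; [exact: ltnW|exact: GU|exact: wd|rewrite wu {1}uG -scalemxAl].
Qed.

(* Invariance under conjugation by the stabilizer of e0, which is what survives
   of the conjugation invariance in size m.+1 once the row e0 is fixed. *)
Definition cinv m (F : 'M[Q]_m -> rat) := forall H H' : 'M[Q]_m,
  H' *m H = 1%:M -> e0 m *m H = e0 m -> forall Y, F (H' *m Y *m H) = F Y.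

Definition mext m (a : Q) (w : 'rV[Q]_m) (b : 'cV[Q]_m) (Y : 'M[Q]_m)
  : 'M[Q]_m.+1 := block_mx a%:M w b Y : 'M[_]_(1 + m).

Lemma avg_mext m (F : 'M[Q]_m.+1 -> rat) :
  avg F = avg (fun w => avg (fun Y => avg (fun b => avg (fun a => F (mext a w b Y))))).
Proof.
pose h (p : 'rV[Q]_m * ('M[Q]_m * ('cV[Q]_m * Q))) :=
  mext p.2.2.2 p.1 p.2.2.1 p.2.1.
have hb : bijective h.
  exists (fun X : 'M[Q]_(1 + m) => (ursubmx X, (drsubmx X, (dlsubmx X, ulsubmx X 0 0)))).
    move=> [w [Y [b a]]]; rewrite /h /mext /=.
    by rewrite block_mxKur block_mxKdr block_mxKdl block_mxKul mxE eqxx mulr1n.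
  by move=> X; rewrite /h /mext /= -mx11_scalar submxK.
rewrite (avg_bij _ hb) avg_pair; apply: eq_avg => w.
rewrite avg_pair; apply: eq_avg => Y.
by rewrite avg_pair; apply: eq_avg => b.
Qed.

(** The block diagonal matrix with blocks 1 and H fixes [e0], so the weak invariance [cinv] suffices
    for an arbitrary invertible H. *)
Lemma mext_conj m a w b (Y H H' : 'M[Q]_m) (F : 'M[Q]_m.+1 -> rat) : cinv F ->
  H' *m H = 1%:M ->
  F (mext a (w *m H) (H' *m b) (H' *m Y *m H)) = F (mext a w b Y).
Proof.
move=> Fc HH; pose B (X : 'M[Q]_m) := block_mx (1%:M : 'M[_]_1) 0 0 X : 'M[_]_(1 + m).
rewrite -[RHS](Fc (B H) (B H')); first last.
- have E0 := mul_row_block (1 : 'M[Q]_1) (0 : 'rV[_]_m) (1%:M : 'M[_]_1) 0 0 H.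
  rewrite mul1mx !mulmx0 !mul0mx !addr0 in E0.
  by rewrite e0S; exact: E0.
- have E0 := mulmx_block (1%:M : 'M[Q]_1) 0 0 H' (1%:M : 'M[_]_1) 0 0 H.
  rewrite !mul0mx !mulmx0 !addr0 !add0r mulmx1 HH -scalar_mx_block in E0.
  exact: E0.
congr F; apply/esym.
have E := mulmx_block (1%:M : 'M[_]_1) 0 0 H' (a%:M : 'M[_]_1) w b Y.
rewrite !mul0mx !mul1mx !addr0 !add0r in E.
have E2 := mulmx_block (a%:M : 'M[_]_1) w (H' *m b) (H' *m Y) (1%:M : 'M[_]_1) 0 0 H.
rewrite !mulmx0 !mulmx1 !addr0 !add0r in E2.
exact: (etrans (congr1 (mulmx ^~ (B H)) E) E2).
Qed.
End Reduction.

Section Functional.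
Variables (k : finFieldType) (M D : nat).
Local Notation Q := {poly %/ ('X^(M.+1) : {poly k})}.
Local Notation q := (#|k|%:R : rat).
Local Notation t := (qt k M).

Definition favg m (F : 'M[Q]_m.+1 -> rat) d (Y : 'M[Q]_m) : rat :=
  avg (fun b => avg (fun a => F (hext (t ^+ d) Y b a))).

Lemma q_gt1 : 1 < q.
Proof. by rewrite (ltr_nat _ 1) card_finNzRing_gt1. Qed.

Lemma q_gt0 : 0 < q. Proof. exact: lt_trans q_gt1. Qed.

Lemma card_Q : #|{: Q}| = (#|k| ^ M.+1)%N.
Proof. by rewrite card_qpoly size_mk_monicXn. Qed.

Lemma avg_dvd_row m d : (d <= M.+1)%N ->
  avg (fun w : 'rV[Q]_m => ([forall i, 'X^d %| val (w 0 i)])%:R) <= q ^- (d * m).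
Proof.
move=> dM; rewrite avg_bool card_mx card_Q mul1n -expnM natrX.
rewrite ler_pdivrMr ?exprn_gt0 ?q_gt0//.
apply: le_trans (_ : (#|k| ^ ((M.+1 - d) * m))%:R <= _).
  by rewrite ler_nat card_dvd_lift_col.
rewrite natrX mulrC -expfB_cond ?gt_eqF ?q_gt0// -?mulnBl//.
by rewrite leq_mul2r dM orbT.
Qed.

(** Averaged over the other entries, F depends on the row w beside the corner only through the
    exponent d of [row_orbit]. Exact exponent d is relaxed to divisibility of w by t^d, of frequency
    at most q^-(d * m.+1), and exponents above D are charged to the bound B. *)
Lemma avg_row_step m (F : 'M[Q]_m.+2 -> rat) B : (D <= M)%N -> cinv F ->
  (forall X, 0 <= F X) -> (forall X, F X <= B) ->
  avg F <= \sum_(d < D.+1) q ^- (d * m.+1) * avg (favg F d) + q ^- D.+1 * B.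
Proof.
move=> DM Fc F0 FB; have B0 : 0 <= B := le_trans (F0 0) (FB 0).
rewrite avg_mext; set Psi := fun w => avg _.
have PsiG w G : G \in unitmx -> Psi (w *m G) = Psi w.
  move=> GU; have HH := mulVmx GU; have HH' := mulmxV GU.
  rewrite /Psi (avg_bij (h := fun Y => invmx G *m Y *m G)); last first.
    exists (fun Y => G *m Y *m invmx G) => Y.
      by rewrite !mulmxA HH' mul1mx -mulmxA HH' mulmx1.
    by rewrite !mulmxA HH mul1mx -mulmxA HH mulmx1.
  apply: eq_avg => Y; rewrite (avg_bij (h := fun b => invmx G *m b)); last first.
    by exists (fun b => G *m b) => b; rewrite mulmxA ?HH ?HH' mul1mx.
  by apply: eq_avg => b; apply: eq_avg => a; exact: mext_conj.
have Psi0 w : 0 <= Psi w by apply: avg_ge0 => Y; apply: avg_ge0 => b; exact: avg_ge0.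
have PsiB w : Psi w <= B.
  by apply: avg_le_cst => // Y; apply: avg_le_cst => // b; exact: avg_le_cst.
have Psid d : avg (favg F d) = Psi (t ^+ d *: e0 m.+1) by [].
pose I d w : bool := [forall i, 'X^d %| val ((w : 'rV[Q]_m.+1) 0 i)].
apply: (@le_trans _ _ (avg (fun w => \sum_(d < D.+1) Psi (t ^+ d *: e0 m.+1) * (I d w)%:R
    + B * (I D.+1 w)%:R))).
  apply: ler_avg => w; have [d [G [dM GU wd wE]]] := row_orbit w.
  have Iw : I d w by apply/forallP.
  have PE : Psi w = Psi (t ^+ d *: e0 m.+1) by rewrite {1}wE PsiG.
  have S0 (P : pred 'I_D.+1) :
      0 <= \sum_(d < D.+1 | P d) Psi (t ^+ d *: e0 m.+1) * (I d w)%:R.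
    by apply: sumr_ge0 => i _; rewrite mulr_ge0.
  have [dD|Dd] := ltnP d D.+1.
    have dE : Psi (t ^+ d *: e0 m.+1) * (I d w)%:R = Psi w by rewrite Iw mulr1 PE.
    by rewrite (bigD1 (Ordinal dD) isT) -addrA -{1}dE lerDl addr_ge0// mulr_ge0.
  suff -> : I D.+1 w by rewrite mulr1 (le_trans (PsiB w))// lerDr.
  by apply/forallP => i; apply: dvdp_trans (wd i); rewrite dvdp_exp2l.
rewrite avgD avg_sum avgZ; apply: lerD.
  apply: ler_sum => d _; rewrite avgZ Psid mulrC ler_wpM2r//.
  by apply: avg_dvd_row; rewrite (leq_trans (ltnW (ltn_ord d))).
rewrite mulrC ler_wpM2r// (le_trans (avg_dvd_row _ _))//.
by rewrite lef_pV2 ?posrE ?exprn_gt0 ?q_gt0// ler_eXn2l ?q_gt1// leq_pmulr.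
Qed.

(* Sum over all exponents ds of the averages over the Hessenberg matrices of
   type ds; the row to the right of the corner of a 1 x 1 matrix is empty,
   whence the single exponent 0 for m' = 0. *)
Fixpoint hsum m : (seq nat -> 'M[Q]_m -> rat) -> rat :=
  if m is m'.+1 then fun F => hsum (m := m') (fun ds Y =>
    \sum_(d < (if m' is 0 then 1 else D.+1)%N) favg (F ((d : nat) :: ds)) d Y)
  else fun F => F [::] 0.

Lemma favg_ge0 m (F : 'M[Q]_m.+1 -> rat) d Y : (forall X, 0 <= F X) -> 0 <= favg F d Y.
Proof. by move=> F0; apply: avg_ge0 => b; exact: avg_ge0. Qed.

Lemma dbound m' (d : 'I_(if m' is 0 then 1 else D.+1)%N) : (d <= D)%N.
Proof. by case: m' d => [|m'] [d /=]; rewrite ltnS// leqn0 => /eqP->. Qed.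

Lemma ler_hsum m (F G : seq nat -> 'M[Q]_m -> rat) :
  (forall ds Y, hess t D ds Y -> F ds Y <= G ds Y) -> hsum F <= hsum G.
Proof.
elim: m F G => [|m IH] F G FG /=; first by apply: FG; exact: Hess0.
apply: IH => ds Y h; apply: ler_sum => d _; apply: ler_avg => b; apply: ler_avg => a.
by apply: FG; apply: HessS => //; exact: dbound.
Qed.

Lemma eq_hsum m (F G : seq nat -> 'M[Q]_m -> rat) :
  (forall ds Y, hess t D ds Y -> F ds Y = G ds Y) -> hsum F = hsum G.
Proof.
by move=> FG; apply/eqP; rewrite eq_le !ler_hsum// => ds Y h; rewrite FG.
Qed.

Lemma hsum_sum m (I : Type) (r : seq I) (P : pred I) (F : I -> seq nat -> 'M[Q]_m -> rat) :
  hsum (fun ds Y => \sum_(i <- r | P i) F i ds Y) = \sum_(i <- r | P i) hsum (F i).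
Proof.
elim: m F => [|m IH] F //=; rewrite -IH; apply: eq_hsum => ds Y h.
rewrite [RHS]exchange_big /=; apply: eq_bigr => d _.
rewrite -avg_sum; apply: eq_avg => b; rewrite -avg_sum; exact: eq_avg.
Qed.

Lemma hsumZ m c (F : seq nat -> 'M[Q]_m -> rat) :
  hsum (fun ds Y => c * F ds Y) = c * hsum F.
Proof.
elim: m F => [|m IH] F //=; rewrite -IH; apply: eq_hsum => ds Y h.
rewrite mulr_sumr; apply: eq_bigr => d _.
by rewrite -avgZ; apply: eq_avg => b; rewrite -avgZ.
Qed.

Lemma cinv_favg m (F : 'M[Q]_m.+1 -> rat) d : cinv F -> cinv (favg F d).
Proof.
move=> Fc H H' HH eH Y; rewrite /favg (avg_bij (h := fun b => H' *m b)); last first.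
  have HH2 := mulmx1C HH.
  by exists (fun b => H *m b) => b; rewrite mulmxA ?HH ?HH2 mul1mx.
apply: eq_avg => b; apply: eq_avg => a.
by rewrite -(mext_conj a (t ^+ d *: e0 m) b Y Fc HH) -scalemxAl eH.
Qed.

Lemma sum_geom_le2 (x : rat) n : 0 <= x -> x <= 1 / 2 -> \sum_(i < n) x ^+ i <= 2.
Proof.
move=> x0 x2; apply: (@le_trans _ _ (2 - x ^+ n * 2)); last first.
  by rewrite gerBl mulr_ge0 ?exprn_ge0.
elim: n => [|n IH]; first by rewrite big_ord0 expr0 mul1r subrr.
rewrite big_ord_recr /=; apply: le_trans (lerD IH (lexx _)) _.
have xn : 0 <= x ^+ n by rewrite exprn_ge0.
by rewrite exprS; nra.
Qed.

Lemma qV_le2 n : q ^- n.+1 <= 1 / 2.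
Proof.
have q2 : 2 <= q by rewrite (ler_nat _ 2) card_finNzRing_gt1.
rewrite div1r lef_pV2 ?posrE ?exprn_gt0 ?q_gt0// (le_trans q2)// -{1}[q]expr1.
by rewrite ler_eXn2l ?q_gt1.
Qed.

(** Induction through [avg_row_step]. The weights q^-(d * m) add up to at most 2, so an error E in
    size m becomes at most 2 * E + q^-(D+1) * B, which the powers of 3 absorb. *)
Lemma avg_le_hsum m (F : 'M[Q]_m -> rat) B : (D <= M)%N -> cinv F ->
  (forall X, 0 <= F X) -> (forall X, F X <= B) ->
  avg F <= hsum (fun ds Y => q ^- wt ds * F Y) + 3 ^+ m * q ^- D.+1 * B.
Proof.
move=> DM; elim: m F B => [|m IH] F B Fc F0 FB.
  have B0 := le_trans (F0 0) (FB 0); rewrite /= expr0 invr1 mul1r.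
  apply: (@le_trans _ _ (F 0)); last first.
    by rewrite lerDl !mulr_ge0 ?invr_ge0 ?exprn_ge0// ltW ?q_gt0.
  by apply: avg_le_cst => // X; rewrite (_ : X = 0)//; apply/matrixP => -[].
have B0 := le_trans (F0 0) (FB 0).
have IHd d := IH (favg F d) B (cinv_favg d Fc)
  (fun Y => favg_ge0 d Y F0).
have IHd' d := IHd d (fun Y => avg_le_cst B0 (fun b => avg_le_cst B0 (fun a => FB _))).
set E := 3 ^+ m * q ^- D.+1 * B in IHd'.
have E0 : 0 <= E by rewrite !mulr_ge0 ?invr_ge0 ?exprn_ge0// ltW ?q_gt0.
pose D' := (if m is 0 then 1 else D.+1)%N.
have S2 : \sum_(d < D') q ^- (d * m) <= 2 :> rat.
  rewrite /D'; case: (m) => [|m']; first by rewrite big_ord1 expr0 invr1.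
  rewrite (eq_bigr (fun d : 'I_D.+1 => (q ^- m'.+1) ^+ d)) => [|d _]; last first.
    by rewrite exprVn -exprM mulnC.
  by apply: sum_geom_le2; rewrite ?qV_le2// invr_ge0 exprn_ge0// ltW ?q_gt0.
have -> : hsum (fun ds Y => q ^- wt ds * F Y) =
    \sum_(d < D') q ^- (d * m) * hsum (fun ds Y => q ^- wt ds * favg F d Y).
  rewrite /= (eq_bigr _ (fun (d : 'I_D') _ => esym (hsumZ _ _))) -hsum_sum.
  apply: eq_hsum => ds Y h; apply: eq_bigr => d _.
  rewrite /= (hess_size h) mulrA -invfM -exprD.
  by rewrite /favg -avgZ; apply: eq_avg => b; rewrite -avgZ.
apply: (@le_trans _ _ (\sum_(d < D') q ^- (d * m) * avg (favg F d) + q ^- D.+1 * B)).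
  (* In size 1 the row beside the corner is empty, and the single exponent 0 accounts for the whole
     average. *)
  rewrite /D'; case: (m) F Fc F0 FB {IH IHd IHd' E E0 S2 D'} => [|m'] F Fc F0 FB.
    rewrite big_ord1 mul0n expr0 invr1 mul1r avg_mext.
    apply: le_trans (_ : avg (favg F 0) <= _); last first.
      by rewrite lerDl mulr_ge0 ?(le_trans (F0 0) (FB 0))// invr_ge0 exprn_ge0// ltW ?q_gt0.
    apply: avg_le_cst => [|w]; first by apply: avg_ge0 => Y; exact: favg_ge0.
    by rewrite (_ : w = t ^+ 0 *: e0 0)//; apply/rowP => -[].
  exact: avg_row_step.
apply: (@le_trans _ _ (\sum_(d < D') q ^- (d * m) *
    hsum (fun ds Y => q ^- wt ds * favg F d Y) + (2 * E + q ^- D.+1 * B))).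
  rewrite addrA lerD2r.
  apply: (@le_trans _ _ (\sum_(d < D') (q ^- (d * m) *
       hsum (fun ds Y => q ^- wt ds * favg F d Y) + q ^- (d * m) * E))).
    apply: ler_sum => d _; rewrite -mulrDr ler_wpM2l ?IHd'//.
  by rewrite big_split /= lerD2l -mulr_suml ler_wpM2r.
have y0 : 0 <= q ^- D.+1 * B by rewrite mulr_ge0 ?invr_ge0 ?exprn_ge0// ltW ?q_gt0.
have z1 : 1 <= 3 ^+ m :> rat by rewrite exprn_ege1.
have aux (y z : rat) : 0 <= y -> 1 <= z -> 2 * (z * y) + y <= 3 * (z * y).
  by move=> ? ?; nra.
by rewrite lerD2l [3 ^+ m.+1]exprS /E -!mulrA; exact: aux.
Qed.
End Functional.

(** * The average number of exponents d with f in J_d *)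

Lemma sum_floor_le (x : rat) n D : (0 < n)%N -> 0 <= x -> x <= 1 / 2 ->
  \sum_(e < D) x ^+ (e %/ n) <= n%:R * 2.
Proof.
move=> n0 x0 x2.
(* The quotient [e %/ n] is constant on blocks of n consecutive exponents. *)
have E L : \sum_(0 <= e < n * L) x ^+ (e %/ n) = n%:R * \sum_(i < L) x ^+ i.
  elim: L => [|L IH]; first by rewrite muln0 big_geq// big_ord0 mulr0.
  rewrite mulnS addnC (big_cat_nat _ (n := n * L)) ?leq_addr//= IH.
  rewrite big_ord_recr /= mulrDr; congr (_ + _).
  rewrite (eq_big_nat _ _ (F2 := fun=> x ^+ L)) => [|i /andP[Li iL]]; last first.
    congr (_ ^+ _); apply/eqP; rewrite eqn_leq -ltnS ltn_divLR// leq_divRL//.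
    by rewrite mulSn addnC [(L * n)%N]mulnC iL Li.
  by rewrite sumr_const_nat addnC addnK mulr_natl.
apply: le_trans (_ : n%:R * \sum_(i < D) x ^+ i <= _); last first.
  by rewrite ler_wpM2l// sum_geom_le2.
rewrite -E -(big_mkord xpredT (fun e => x ^+ (e %/ n))).
rewrite [leRHS](big_cat_nat _ (n := D)) ?leq_pmull//= lerDl.
by apply: sumr_ge0 => i _; rewrite exprn_ge0.
Qed.

Section Count.
Variables (k : finFieldType) (M D : nat).
Local Notation Q := {poly %/ ('X^(M.+1) : {poly k})}.
Local Notation q := (#|k|%:R : rat).
Local Notation t := (qt k M).

Definition qlift (x : Q) : {poly k} := val x.
Definition lmx m n (Y : 'M[Q]_(m, n)) : 'M[{poly k}]_(m, n) := map_mx qlift Y.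

Lemma lmx_hext m d (Y : 'M[Q]_m) b a : (d <= M)%N ->
  lmx (hext (t ^+ d) Y b a) = hext 'X^d (lmx Y) (lmx b) (qlift a).
Proof.
move=> dM; rewrite /lmx /hext -[m.+1]/(1 + m)%N map_block_mx.
have -> : map_mx qlift (a%:M : 'M[_]_1) = (qlift a)%:M.
  by apply/matrixP => i j; rewrite !mxE !ord1 !mulr1n.
suff -> : map_mx qlift (t ^+ d *: e0 m) = 'X^d *: e0 m by [].
apply/matrixP => i j; rewrite !mxE; case: (_ == _).
  by rewrite !mulr1 /qlift lift_qt.
by rewrite !mulr0.
Qed.

Lemma hess_lift m ds (Y : 'M[Q]_m) : (D <= M)%N ->
  hess t D ds Y -> hess 'X D ds (lmx Y).
Proof.
move=> DM; elim=> [{}Y|{}m {}ds {}Y d b a dD _ IH]; first exact: Hess0.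
by rewrite lmx_hext ?(leq_trans dD)//; exact: HessS.
Qed.

(** Membership is tested over k[t] instead of its truncation because [card_sublevel] concerns
    polynomials with coefficients in k[t]. *)
Definition jind m d (Y : 'M[Q]_m) (f : {poly {poly k}}) : rat :=
  (`[< inJ 'X^d (lmx Y) f >])%:R.

Lemma jind_ge0 m d (Y : 'M[Q]_m) f : 0 <= jind d Y f.
Proof. exact: ler0n. Qed.

(** If f is not in the ideal of Y, it is in no ideal of an extension, by [inJ_hext]. Otherwise d' =
    0 counts for at most 1, and d' = e + 1 forces t^d' to divide psi(a), of frequency at most n
    q^-floor(e / n); the sum over e is at most n times 2 n. *)
Lemma favg_jind m ds (Y : 'M[Q]_m) d f n : (D <= M)%N -> hess t D ds Y ->
  (d <= D)%N -> f \is monic -> size f = n.+1 -> (m < n)%N ->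
  favg (fun Y' => \sum_(d' < D.+1) jind d' Y' f) d Y <=
    (1 + n%:R * (n%:R * 2)) * jind d Y f.
Proof.
move=> DM h dD fm fs mn.
have C0 : 0 <= 1 + n%:R * (n%:R * 2) :> rat by rewrite addr_ge0// !mulr_ge0.
apply: avg_le_cst => [|b]; first by rewrite mulr_ge0 ?jind_ge0.
have [fJ|fJ] := pselect (inJ 'X^d (lmx Y) f); last first.
  apply: avg_le_cst => [|a]; first by rewrite mulr_ge0 ?jind_ge0.
  rewrite big1 ?mulr_ge0 ?jind_ge0// => d' _; rewrite /jind.
  case: asboolP => //; rewrite lmx_hext ?(leq_trans dD)//.
  by move/inJ_hext/fJ.
rewrite /jind (asboolT fJ) mulr1.
have [psi [psim psis H]] := inJ_hext_dvd (lmx b) (hess_lift DM h) fm fs (ltnW mn) fJ.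
apply: (@le_trans _ _ (avg (fun a : Q =>
    \sum_(e < D.+1) ('X^e %| psi.[val a])%R%:R))).
  apply: ler_avg => a; apply: ler_sum => d' _; case: asboolP => // J.
  move: J; rewrite lmx_hext ?(leq_trans dD)// => /H[u ->].
  by rewrite dvdp_mulr.
rewrite avg_sum big_ord_recl; apply: lerD.
  by apply: avg_le_cst => // a; rewrite lern1 leq_b1.
apply: (@le_trans _ _ (\sum_(e < D) n%:R * q^-1 ^+ (e %/ n))).
  apply: ler_sum => e _; rewrite avg_bool card_Q.
  have n0 : (0 < n)%N by exact: leq_ltn_trans mn.
  have eM : (e %/ n <= M.+1)%N.
    by rewrite (leq_trans (leq_div _ _))// (leq_trans (ltnW (ltn_ord e)))// ltnW.
  (* The shift of the exponent by one makes the inequality strict, as [card_sublevel] requires. *)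
  have rs : ((n - m) * (e %/ n) < e.+1)%N.
    by rewrite ltnS (leq_trans _ (leq_divM e n))// mulnC leq_mul2l leq_subr orbT.
  have qM : 0 < q ^+ M.+1 by rewrite exprn_gt0 ?q_gt0.
  rewrite natrX ler_pdivrMr// -mulrA.
  apply: (@le_trans _ _ (n%:R * (#|k| ^ (M.+1 - e %/ n))%:R)).
    rewrite -natrM ler_nat (leq_trans (card_sublevel M psim psis rs))//.
    by rewrite leq_mul2r leq_subr orbT.
  by rewrite natrX ler_wpM2l// expfB_cond ?gt_eqF ?q_gt0// exprVn mulrC.
rewrite -mulr_sumr ler_wpM2l//; apply: sum_floor_le.
- exact: leq_ltn_trans mn.
- by rewrite invr_ge0 ltW ?q_gt0.
- by have := qV_le2 k 0; rewrite expr1.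
Qed.

(** Each border costs one factor from [favg_jind], down to size 0, where the single exponent 0
    contributes at most 1. *)
Lemma hsum_jind m f n : (D <= M)%N -> f \is monic -> size f = n.+1 -> (m < n)%N ->
  hsum D (fun ds (Y : 'M[Q]_m) =>
     \sum_(d < (if m is 0 then 1 else D.+1)%N) jind d Y f) <=
  (1 + n%:R * (n%:R * 2)) ^+ m.
Proof.
move=> DM fm fs; elim: m => [|m IH] mn /=.
  by rewrite big_ord1 expr0 /jind lern1 leq_b1.
apply: (@le_trans _ _ (hsum D (fun ds (Y : 'M[Q]_m) => (1 + n%:R * (n%:R * 2)) *
    \sum_(d < (if m is 0 then 1 else D.+1)%N) jind d Y f))).
  apply: ler_hsum => ds Y h; rewrite mulr_sumr; apply: ler_sum => d _.
  by apply: (favg_jind DM h) => //; [exact: dbound|exact: ltnW].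
by rewrite hsumZ [leRHS]exprS ler_wpM2l ?IH ?(ltnW mn)// addr_ge0// !mulr_ge0.
Qed.
End Count.

(** * Counting matrices whose characteristic polynomial is close to a given one *)

Section MonicOfRow.
Variables (A : comNzRingType) (n : nat).

Definition monic_of_row (u : 'rV[A]_n) : {poly A} := 'X^n + rVpoly u.

Lemma size_monic_of_row u : size (monic_of_row u) = n.+1.
Proof. by rewrite size_polyDl size_polyXn// ltnS size_poly. Qed.

Lemma monic_of_row_monic u : monic_of_row u \is monic.
Proof.
by rewrite monicE lead_coefDl ?size_polyXn ?ltnS ?size_poly// lead_coefXn.
Qed.

Lemma coef_monic_of_row u (i : 'I_n) : (monic_of_row u)`_i = u 0 i.
Proof. by rewrite coefD coefXn (ltn_eqF (ltn_ord i)) add0r coef_rVpoly_ord. Qed.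

Lemma monic_of_rowK (f : {poly A}) : f \is monic -> size f = n.+1 ->
  monic_of_row (\row_(i < n) f`_i) = f.
Proof.
move=> fm fs; apply/polyP => i; have [ni|] := ltnP i n.
  by rewrite (coef_monic_of_row _ (Ordinal ni)) mxE.
rewrite leq_eqVlt => /predU1P[<-|ni]; last first.
  by rewrite !nth_default// ?size_monic_of_row ?fs.
have := monic_of_row_monic (\row_(i < n) f`_i).
by move: fm; rewrite !monicE !lead_coefE fs size_monic_of_row => /eqP-> /eqP->.
Qed.
End MonicOfRow.

Lemma map_monic_of_row (A B : comNzRingType) (h : {rmorphism A -> B}) n (u : 'rV[A]_n) :
  map_poly h (monic_of_row u) = monic_of_row (map_mx h u).
Proof.
apply: esym; rewrite -[RHS](monic_of_rowK (n := n)) ?monic_map ?monic_of_row_monic//.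
  by congr monic_of_row; apply/rowP => i; rewrite !mxE coef_map coef_monic_of_row.
by rewrite size_map_poly_id0 ?size_monic_of_row// (eqP (monic_of_row_monic _)) rmorph1 oner_neq0.
Qed.

Lemma char_poly_conj (A : comNzRingType) n (H H' Y : 'M[A]_n) : H' *m H = 1%:M ->
  char_poly (H' *m Y *m H) = char_poly Y.
Proof.
move=> HH; have HH2 := mulmx1C HH.
have mHH : map_mx polyC H' *m map_mx polyC H = 1%:M by rewrite -map_mxM HH map_mx1.
rewrite /char_poly; have -> : char_poly_mx (H' *m Y *m H) =
    map_mx polyC H' *m char_poly_mx Y *m map_mx polyC H.
  by rewrite /char_poly_mx mulmxBr mulmxBl -!map_mxM mul_mx_scalar -scalemxAl mHH scalemx1.
by rewrite !det_mulmx mulrAC -det_mulmx mHH det1 mul1r.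
Qed.

Section CharPolyCount.
Variables (k : finFieldType) (M D : nat).
Local Notation Q := {poly %/ ('X^(M.+1) : {poly k})}.
Local Notation q := (#|k|%:R : rat).
Local Notation t := (qt k M).

Lemma in_qpoly_lmx m n (Y : 'M[Q]_(m, n)) : map_mx (in_qpoly 'X^(M.+1)) (lmx Y) = Y.
Proof. by apply/matrixP => i j; rewrite !mxE; exact: liftK. Qed.

Lemma hess_sumn (A : comNzRingType) (u : A) m ds (Y : 'M[A]_m) :
  hess u D ds Y -> (sumn ds <= m * D)%N.
Proof.
elim=> // {}m {}ds {}Y d b a dD _ IH /=.
by rewrite mulSn leq_add.
Qed.

(** The lifted polynomial and the characteristic polynomial of the lifted extension differ by a
    multiple of t^(M+1). The latter polynomial lies in the ideal, and [inJ_pow] puts the difference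
    there too, as the exponents add up to at most M.+1. *)
Lemma inJ_lift m ds (Y : 'M[Q]_m) d b a (u : 'rV[Q]_m.+1) :
  (m.+1 * D <= M.+1)%N -> (D <= M)%N -> hess t D ds Y -> (d <= D)%N ->
  char_poly (hext (t ^+ d) Y b a) = monic_of_row u ->
  inJ 'X^d (lmx Y) (monic_of_row (lmx u)).
Proof.
move=> nDM DM h dD E.
set f := monic_of_row _; set X := hext 'X^d (lmx Y) (lmx b) (qlift a).
have fX : map_poly (in_qpoly 'X^(M.+1)) (f - char_poly X) = 0.
  rewrite rmorphB /= map_monic_of_row in_qpoly_lmx -E map_char_poly /X -lmx_hext.
    by rewrite in_qpoly_lmx subrr.
  exact: leq_trans dD DM.
pose g := map_poly (fun a : {poly k} => a %/ 'X^(M.+1)) (f - char_poly X).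
have gE : f = char_poly X + ('X^(M.+1))%:P * g.
  apply/eqP; rewrite addrC -subr_eq; apply/eqP.
  apply/polyP => i; rewrite mul_polyC coefZ coef_map_id0 ?div0p// mulrC divpK//.
  have := congr1 (fun p : {poly Q} => p`_i) fX; rewrite coef_map coef0 => /eqP.
  by rewrite in_qpoly_eq0.
have hl := hess_lift DM h.
have sM : (d + sumn ds <= M.+1)%N.
  by rewrite (leq_trans _ nDM)// mulSn leq_add// (hess_sumn h).
have [c [r E2]] := inJ_pow d (('X^(M.+1 - (d + sumn ds)))%:P * g) hl.
exists (c - lmx b), (r + ('X - (qlift a)%:P)).
rewrite gE char_poly_hext; rewrite mulrA -polyCM -exprD subnKC// in E2.
rewrite E2 rdotD rdotN mulrBr.
have rearrange (S : comNzRingType) (x y z v w : S) :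
  x * y - z + (v + y * w) = v - z + y * (w + x) by ring.
exact: rearrange.
Qed.

Definition near_row n N (c : nat -> {poly k}) (u : 'rV[Q]_n) :=
  [forall i : 'I_n, 'X^N %| qlift (u 0 i) - c i].

Lemma card_near_row n N c : (#|[set u : 'rV[Q]_n | near_row N c u]| <= #|k| ^ ((M.+1 - N) * n))%N.
Proof.
set S := [set u | _].
have [->|/finset.set0Pn[u0 u0S]] := eqVneq S finset.set0; first by rewrite cards0.
rewrite inE in u0S; rewrite (leq_trans _ (card_dvd_lift_col k M n N))//.
rewrite -(card_imset S (addIr (- u0))) subset_leq_card//.
apply/fintype.subsetP => _ /imsetP[u uS ->]; rewrite inE in uS; rewrite inE.
apply/forallP => i; rewrite !mxE liftB.
rewrite -[val _](subrK (c i)) -addrA.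
by rewrite dvdp_add ?(forallP uS i)// -opprB dvdpNr (forallP u0S i).
Qed.

(** After Hessenberg reduction, the indicator is split according to the exact value u. A fiber is
    empty unless the polynomial of u is in the ideal ([inJ_lift]), and the weight compensates its
    size ([card_char_poly_hext]). There remain [hsum_jind] for each u and the number of admissible
    u, at most q^((M+1-N) n). *)
Lemma avg_near_char_poly n N c : (0 < n)%N -> (N <= M.+1)%N ->
    (n * D <= M.+1)%N -> (D <= M)%N ->
  avg (fun X : 'M[Q]_n => (near_row N c (\row_(i < n) (char_poly X)`_i))%:R) <=
  (1 + n%:R * (n%:R * 2)) ^+ n.-1 * q ^- (N * n) + 3 ^+ n * q ^- D.+1.
Proof.
case: n => // n _ NM nDM DM /=; set F : 'M[Q]_n.+1 -> rat := fun X => _.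
set C := 1 + _.
have Fc : cinv F by move=> H H' HH _ Y; rewrite /F char_poly_conj.
apply: le_trans (avg_le_hsum (B := 1) DM Fc (fun X => ler0n _ _) _) _.
  by move=> X; rewrite lern1 leq_b1.
rewrite mulr1 lerD2r /=; set U := [set u : 'rV[Q]_n.+1 | near_row N c u].
(* The inverse of the number of borders (b, a). *)
pose W := q ^- (M.+1 * n.+1).
have W0 : 0 <= W by rewrite invr_ge0 exprn_ge0// ltW ?q_gt0.
apply: (@le_trans _ _ (hsum D (fun ds (Y : 'M[Q]_n) => W * \sum_(u in U)
     \sum_(d < (if n is 0 then 1 else D.+1)%N) jind d Y (monic_of_row (lmx u))))).
  apply: ler_hsum => ds Y h; rewrite exchange_big mulr_sumr; apply: ler_sum => d _.
  have dD := dbound d.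
  rewrite /favg -(avg_pair (fun ba : 'cV[Q]_n * Q => q ^- _ * F (hext _ _ ba.1 ba.2))) avgZ.
  have qw : 0 < q ^+ wt ((d : nat) :: ds) by rewrite exprn_gt0 ?q_gt0.
  rewrite ler_pdivrMl// mulrCA mulr_sumr.
  pose R (u : 'rV[Q]_n.+1) (ba : 'cV[Q]_n * Q) :=
    char_poly (hext (t ^+ d) Y ba.1 ba.2) == monic_of_row u.
  apply: le_trans (_ : avg (fun ba => \sum_(u in U) (R u ba)%:R) <= _).
    apply: ler_avg => ba; rewrite /F; set u := \row_i _.
    have Ru : R u ba.
      by rewrite /R monic_of_rowK ?char_poly_monic ?size_char_poly.
    case nu: (near_row N c u); last by apply: sumr_ge0.
    by rewrite (bigD1 u) ?inE//= Ru lerDl; apply: sumr_ge0.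
  rewrite avg_sum mulr_sumr; apply: ler_sum => u _.
  rewrite avg_bool card_prod card_mx card_Q -expnSr muln1 -expnM natrX.
  rewrite mulrC -/W ler_wpM2l//.
  have [->|/finset.set0Pn[[b a]]] := eqVneq [set ba | R u ba] finset.set0.
    by rewrite cards0 mulr_ge0 ?jind_ge0// ltW.
  rewrite inE => /eqP/(inJ_lift nDM DM h dD)/asboolT J.
  rewrite /jind J mulr1 -natrX ler_nat.
  by apply: leq_trans (card_char_poly_hext d (monic_of_row u) h).
rewrite hsumZ hsum_sum mulrC.
apply: (@le_trans _ _ ((\sum_(u in U) C ^+ n) * W)).
  rewrite ler_wpM2r//; apply: ler_sum => u _; apply: hsum_jind => //.
    exact: monic_of_row_monic.
  exact: size_monic_of_row.
rewrite sumr_const -[_ ^+ _ *+ _]mulr_natl -mulrA mulrCA ler_wpM2l//.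
  by rewrite exprn_ge0// addr_ge0// !mulr_ge0.
apply: (@le_trans _ _ ((#|k| ^ ((M.+1 - N) * n.+1))%:R * W)).
  by rewrite ler_wpM2r// ler_nat card_near_row.
rewrite natrX /W mulnBl expfB_cond ?gt_eqF ?q_gt0//; last by rewrite leq_mul2r NM orbT.
by rewrite mulrAC divff ?mul1r// expf_neq0 ?gt_eqF ?q_gt0.
Qed.
End CharPolyCount.

(** * Haar measure of balls in matrix spaces over k((t)) *)

Local Open Scope classical_set_scope.
Local Open Scope ring_scope.

Section Box.
Variables (k : fieldType) (m n : nat).
Local Notation V := 'M[laurent k]_(m, n).
Implicit Types (X Y : V) (s N : int).

Definition box s : set V := [set X : V | forall i j, below (X i j) s].

Lemma below0 s : below (0 : laurent k) s.
Proof. by []. Qed.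

Lemma belowD s (x y : laurent k) : below x s -> below y s -> below (x + y) s.
Proof. by move=> xs ys l ls; rewrite /= xs// ys// addr0. Qed.

Lemma belowN s (x : laurent k) : below x s -> below (- x) s.
Proof. by move=> xs l ls; rewrite /= xs// oppr0. Qed.

Lemma box0 s : box s 0.
Proof. by move=> i j; rewrite mxE. Qed.

Lemma boxD s X Y : box s X -> box s Y -> box s (X + Y).
Proof. by move=> Xs Ys i j; rewrite mxE; exact: belowD. Qed.

Lemma boxN s X : box s X -> box s (- X).
Proof. by move=> Xs i j; rewrite mxE; exact: belowN. Qed.

Lemma boxB s X Y : box s X -> box s Y -> box s (X - Y).
Proof. by move=> Xs Ys; apply: boxD => //; exact: boxN. Qed.

Lemma box_le s N : s <= N -> box N `<=` box s.
Proof. by move=> sN X XN i j; exact: below_le (XN i j). Qed.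

Lemma box_ex X : exists N : nat, box (- N%:Z) X.
Proof.
have /choice[a aP] (ij : 'I_m * 'I_n) : exists a : int, below (X ij.1 ij.2) a.
  exact: laurent_below.
exists (\sum_ij `|a ij|)%N => i j; apply: below_le (aP (i, j)).
by rewrite (bigD1 (i, j))//=; lia.
Qed.

Lemma nbhs_laurentP (x : laurent k) (A : set (laurent k)) :
  nbhs x A <-> exists N : int, forall y, below (y - x) N -> A y.
Proof.
rewrite -nbhs_entourageE; split.
  move=> [E [N _ NE] EA]; exists N => y yx; apply: EA; apply/xsectionP; apply: NE => l lN /=.
  by rewrite -opprB -[_ - _]/((y - x) l) yx// oppr0.
move=> [N NA]; exists (@tadic_rel k N); first by exists N.
move=> y /xsectionP xy; apply: NA => l lN /=.
by rewrite -opprB -[_ - _]/((x - y) l) xy// oppr0.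
Qed.

Lemma nbhs_boxP X (A : set V) :
  nbhs X A <-> exists N : nat, forall Y, box N%:Z (Y - X) -> A Y.
Proof.
split.
  move=> [P PX PA].
  have /choice[a aP] (ij : 'I_m * 'I_n) :
      exists a : int, forall y, below (y - X ij.1 ij.2) a -> P ij.1 ij.2 y.
    by apply/nbhs_laurentP; exact: PX.
  exists (\sum_ij `|a ij|)%N => Y YX; apply: PA => i j.
  apply: (aP (i, j)); have := YX i j; rewrite !mxE; apply: below_le.
  by rewrite (bigD1 (i, j))//=; lia.
move=> [N NA]; exists (fun i j => [set y | below (y - X i j) N%:Z]).
  by move=> i j; apply/nbhs_laurentP; exists N%:Z.
by move=> Y YP; apply: NA => i j; rewrite !mxE; exact: YP.
Qed.

(** These sets are the unions of cosets of the open subgroup [box N]; they are open and closed. *)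
Definition box_inv N (A : set V) := forall X Y, A X -> box N (Y - X) -> A Y.

Lemma box_inv_open N A : box_inv N A -> open A.
Proof.
move=> AN; rewrite openE => X AX; apply/nbhs_boxP.
by exists `|N|%N => Y YX; apply: AN AX _; apply: box_le YX; lia.
Qed.

Lemma box_inv_measurable N A : box_inv N A -> measurable (A : set (borel V)).
Proof. by move=> /box_inv_open oA; exact: sub_sigma_algebra. Qed.

Lemma box_inv_box s N : s <= N -> box_inv N (box s).
Proof.
move=> sN X Y Xs YX; rewrite -(subrK X Y); apply: boxD => //.
exact: box_le YX.
Qed.

Lemma box_inv_coset s X : box_inv s [set Y : V | box s (Y - X)].
Proof.
move=> Y Z /= YX ZY; rewrite -(subrK Y Z) -addrA; exact: boxD.
Qed.

Lemma measurable_box s : measurable (box s : set (borel V)).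
Proof. exact: (box_inv_measurable (box_inv_box (lexx s))). Qed.

Lemma compact_sub_box (K : set V) : compact K -> exists N : nat, K `<=` box (- N%:Z).
Proof.
move=> /compact_near_coveringP cK.
have : \forall i \near \oo, K `<=` box (- (i : nat)%:Z).
  apply: cK => X KX; have [i Xi] := box_ex X.
  exists ([set Y : V | box 0 (Y - X)], [set j | (i <= j)%N]).
    split; last by exists i.
    by apply/nbhs_boxP; exists 0%N.
  move=> [Y j] [/= YX ij]; rewrite -(subrK X Y).
  by apply: boxD; [apply: box_le YX|apply: box_le Xi]; lia.
by case=> i _ iK; exists i; apply: iK => /=.
Qed.

Lemma hausdorff_mx : hausdorff_space V.
Proof.
move=> X Y XY; apply/matrixP => i j; apply/laurentP => l.
have nX (Z : V) : nbhs Z [set W : V | box ((absz l).+1)%:Z (W - Z)].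
  by apply/nbhs_boxP; exists ((absz l).+1).
have [Z [ZX ZY]] := XY _ _ (nX X) (nX Y).
have := ZX i j l; have := ZY i j l; rewrite !mxE => /(_ _)/eqP h1 /(_ _)/eqP h2.
have ll : l < ((absz l).+1)%:Z by lia.
by move: (h1 ll) (h2 ll); rewrite /= !subr_eq0 => /eqP <- /eqP <-.
Qed.

Lemma compact_measurable (K : set V) : compact K -> measurable (K : set (borel V)).
Proof.
move=> /(compact_closed hausdorff_mx) cK.
rewrite -(setCK K); apply: measurableC; apply: sub_sigma_algebra.
exact: closed_openC.
Qed.
End Box.

Lemma ultra_fin_fiber (T : Type) (U : finType) (F : set_system T) (f : T -> U) :
  UltraFilter F -> exists c, F [set x | f x = c].
Proof.
move=> UF; apply: contrapT => /forallNP nF.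
have : F (fun x => forall c, ~ f x = c).
  by apply: filter_forall => c; have [/nF|] := in_ultra_setVsetC [set x | f x = c] UF.
by move=> /filter_ex[x /(_ (f x))].
Qed.

(** As k is finite, an ultrafilter selects one value for each coefficient of each entry, and these
    values define its limit: closeness to the limit at a given precision involves finitely many
    coefficients. *)
Lemma compact_box (k : finFieldType) m n s : compact (@box k m n s).
Proof.
rewrite compact_ultra => F UF FB.
have /choice[c cF] (ijl : 'I_m * 'I_n * int) : exists c,
    F [set X : 'M[laurent k]_(m, n) | X ijl.1.1 ijl.1.2 ijl.2 = c].
  exact: ultra_fin_fiber.
have cs i j : below (fun l => c (i, j, l)) s.
  move=> l ls; have [X [XB <-]] := filter_ex (filterI FB (cF (i, j, l))).
  exact: XB.
pose Y : 'M[laurent k]_(m, n) := \matrix_(i, j) mkl (cs i j).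
exists Y; split; first by move=> i j; rewrite mxE; exact: cs.
move=> A /nbhs_boxP[N NA].
have FN : F (fun X : 'M[laurent k]_(m, n) => forall ijl : 'I_m * 'I_n * 'I_(absz (N%:Z - s)),
    X ijl.1.1 ijl.1.2 (s + (ijl.2 : nat)%:Z) =
      c (ijl.1.1, ijl.1.2, s + (ijl.2 : nat)%:Z)).
  by apply: filter_forall => ijl; exact: (cF (ijl.1.1, ijl.1.2, _)).
apply: filterS (filterI FB FN) => X [XB XN]; apply: NA => i j l lN.
rewrite !mxE /=; have [ls|sl] := ltP l s; first by rewrite XB// cs// subrr.
have lN' : (absz (l - s) < absz (N%:Z - s))%N by lia.
have := XN (i, j, Ordinal lN') => /=; rewrite (_ : s + _ = l); last by lia.
by move=> ->; rewrite subrr.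
Qed.

Fact lrep_below (k : fieldType) (s : int) (p : {poly k}) :
  below (fun l : int => if l < s then 0 else p`_(absz (l - s))) s.
Proof. by move=> l ->. Qed.
(** The Laurent polynomial t^s p(t). *)
Definition lrep (k : fieldType) (s : int) (p : {poly k}) : laurent k :=
  mkl (@lrep_below k s p).

Section Cosets.
Variables (k : finFieldType) (m n M : nat).
Local Notation V := 'M[laurent k]_(m, n).
Local Notation Q := {poly %/ ('X^(M.+1) : {poly k})}.
Implicit Types (X Y : V) (s : int).

(** The class of t^-s x modulo t^(M+1), for x in t^s k[[t]]. *)
Definition ltrunc s (x : laurent k) : Q :=
  in_qpoly 'X^(M.+1) (\poly_(i < M.+1) x (s + i%:Z)).

Definition mtrunc s X : 'M[Q]_(m, n) := \matrix_(i, j) ltrunc s (X i j).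

Lemma coef_ltrunc s x (i : nat) : (i <= M)%N ->
  (val (ltrunc s x))`_i = x (s + i%:Z).
Proof. by move=> iM; rewrite in_qpolyK ?size_poly// coef_poly ltnS iM. Qed.

Definition mrep s (r : 'M[Q]_(m, n)) : V := \matrix_(i, j) lrep s (val (r i j)).

Lemma box_mrep s r : box s (mrep s r).
Proof. by move=> i j; rewrite mxE; exact: lrep_below. Qed.

Lemma mrep_mtrunc s X : box s X -> box (s + M.+1%:Z) (X - mrep s (mtrunc s X)).
Proof.
move=> Xs i j l lM; rewrite !mxE /=; case: ltP => ls.
  by rewrite Xs// subr0.
rewrite coef_ltrunc; last by lia.
by rewrite (_ : s + _ = l) ?subrr//; lia.
Qed.

Lemma mtrunc_coset s X r : box (s + M.+1%:Z) (X - mrep s r) -> mtrunc s X = r.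
Proof.
move=> Xr; apply/matrixP => i j; rewrite !mxE -[RHS]liftK.
congr in_qpoly; apply/polyP => l; rewrite coef_poly; case: ltnP => lM.
  have := Xr i j (s + l%:Z); rewrite !mxE /= => /(_ _)/eqP; rewrite subr_eq0.
  by move=> /(_ _)/eqP ->; [rewrite ifF; [congr (_`_ _); lia|lia]|lia].
by rewrite nth_default// (leq_trans (size_lift _)).
Qed.

(** The fibers of [mtrunc] on [box s] are the cosets of [box (s + M.+1)]; through this, counts over
    the truncated ring become Haar measures. *)
Lemma mtrunc_preimageE s (S : {set 'M[Q]_(m, n)}) :
  box s `&` [set X : V | mtrunc s X \in S] =
  \bigcup_(r in [set` enum S]) [set X : V | box (s + M.+1%:Z) (X - mrep s r)].
Proof.
apply/seteqP; split => [X [Xs XS]|X [r rS Xr]].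
  by exists (mtrunc s X); rewrite /= ?mem_enum//; exact: mrep_mtrunc.
split; last by rewrite /= (mtrunc_coset Xr); rewrite /= mem_enum in rS.
rewrite -(subrK (mrep s r) X); apply: boxD; last exact: box_mrep.
by apply: box_le Xr; lia.
Qed.
End Cosets.

Section HaarBox.
Variables (R : realType) (k : finFieldType) (m n : nat).
Local Notation V := 'M[laurent k]_(m, n).
Variables (nu : {measure set (borel V) -> \bar R}) (hnu : is_haar nu).
Local Notation q := (#|k|).

Lemma haar_box_fin s : (nu (box s) < +oo)%E.
Proof. by have [_ + _] := hnu; apply; exact: compact_box. Qed.

Lemma haar_box_fin_num s : nu (box s) \is a fin_num.
Proof. by rewrite ge0_fin_numE ?haar_box_fin. Qed.

Lemma haar_coset s X : nu [set Y : V | box s (Y - X)] = nu (box s).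
Proof.
have [+ _ _] := hnu => /(_ X _ (measurable_box s)) <-; congr (nu _).
apply/seteqP; split => [Y /= YX|_ [Z Zs <-]] /=.
  by exists (Y - X) => //; rewrite addrC subrK.
by rewrite addrC addKr.
Qed.

Lemma haar_mtrunc M s (S : {set ('M[{poly %/ ('X^(M.+1) : {poly k})}]_(m, n))}) :
  nu (box s `&` [set X : V | mtrunc M s X \in S]) =
  ((#|S|)%:R%:E * nu (box (s + M.+1%:Z)))%E.
Proof.
rewrite mtrunc_preimageE measure_fin_bigcup//; first last.
- by move=> r _; apply: box_inv_measurable; exact: box_inv_coset.
- move=> r r' _ _ [X [Xr Xr']].
  by rewrite -(mtrunc_coset Xr) -(mtrunc_coset Xr').
rewrite -fsbig_seq ?enum_uniq//.
rewrite (eq_bigr (fun=> nu (box (s + M.+1%:Z)))) => [|r _]; last exact: haar_coset.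
rewrite -(fineK (haar_box_fin_num _)) sumEFin big_const_seq iter_addr_0.
by rewrite count_predT -cardE -EFinM mulr_natl.
Qed.

Lemma haar_box_split M s :
  nu (box s) = ((q ^ (M.+1 * (m * n)))%:R%:E * nu (box (s + M.+1%:Z)))%E.
Proof.
have := @haar_mtrunc M s [set: _]%SET.
rewrite cardsT card_mx card_Q -expnM => <-; congr (nu _).
by apply/seteqP; split=> [X Xs|X []//]; split => //=; rewrite inE.
Qed.

(** Each larger box is a finite union of translates of [box s]; were the latter null, the whole
    space would be null, being a countable union of boxes. *)
Lemma haar_box_gt0 s : (0 < nu (box s))%E.
Proof.
rewrite lt0e measure_ge0 andbT; apply/negP => /eqP s0.
have [_ _ /negP] := hnu; apply; apply/eqP.
have b0 (i : nat) : nu (box (s - i%:Z)) = 0%E.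
  case: i => [|i]; first by rewrite subr0.
  by rewrite (haar_box_split i) subrK s0 mule0.
apply/eqP; rewrite eq_le measure_ge0 andbT.
have -> : [set: V] = \bigcup_i box (s - (i : nat)%:Z).
  apply/seteqP; split => // X _; have [N XN] := box_ex X.
  by exists (N + absz s)%N => //; apply: box_le XN; lia.
apply: le_trans (measure_sigma_subadditive _ _ _ (fun=> id)) _.
- by move=> i; exact: measurable_box.
- by apply: bigcupT_measurable => i; exact: measurable_box.
by rewrite eseries0.
Qed.
End HaarBox.

(** * The Chevalley map over k((t)) *)

Section Emb.
Variable k : fieldType.
Implicit Types (p q : {poly k}) (x y : laurent k) (a b s : int).

Lemma belowM x y a b : below x a -> below y b -> below (x * y) (a + b).
Proof. exact: conv_below. Qed.

Definition emb p : laurent k := lrep 0 p.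

Lemma embE p (i : nat) : emb p i%:Z = p`_i.
Proof. by rewrite /emb /= addn0. Qed.

Lemma emb_below p : below (emb p) 0.
Proof. exact: lrep_below. Qed.

Fact emb_is_zmod_morphism : zmod_morphism emb.
Proof.
move=> p q; apply/laurentP => l; rewrite /emb /=.
by case: ifP => _; rewrite ?subrr// coefB.
Qed.

Fact emb_is_monoid_morphism : monoid_morphism emb.
Proof.
split; first apply/laurentP => l; rewrite /emb /=.
  by rewrite /lone_coef coef1; case: ltP => l0; [rewrite lt_eqF|congr (nat_of_bool _)%:R; lia].
move=> p q; apply/laurentP.
apply: (@eq_below _ _ _ (0 + 0)); first by rewrite addr0; exact: emb_below.
  by apply: conv_below; exact: emb_below.
move=> s; rewrite [RHS](convE (@emb_below p) (@emb_below q) (leqnn s)).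
rewrite addr0 add0r embE.
have t (r : {poly k}) i : (i <= s)%N -> r`_i = (trunc (emb r) 0 s)`_i.
  by move=> si; rewrite coef_trunc// add0r embE.
by rewrite (coefM_eql _ (t p)) (coefM_eqr _ (t q)).
Qed.

HB.instance Definition _ :=
  GRing.isZmodMorphism.Build {poly k} (laurent k) emb emb_is_zmod_morphism.
HB.instance Definition _ :=
  GRing.isMonoidMorphism.Build {poly k} (laurent k) emb emb_is_monoid_morphism.

Lemma below_emb_Xn p N : 'X^N %| p -> below (emb p) N%:Z.
Proof.
move=> /dvdpP[r ->] l lN; rewrite /emb /=; case: ltP => // l0.
by rewrite coefMXn ifT//; lia.
Qed.

Lemma below_emb p N : below (emb p) N%:Z -> 'X^N %| p.
Proof.
move=> pN; apply/dvdpP; exists (\poly_(i < size p) p`_(i + N)).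
apply/polyP => i; rewrite coefMXn; case: ltnP => iN.
  by rewrite -embE pN//; lia.
rewrite coef_poly; case: ltnP => iN2; first by rewrite subnK.
by rewrite nth_default// (leq_trans iN2)// leq_subr.
Qed.

(** The power t^s of the uniformizer, for s of any sign. *)
Definition tm s : laurent k := lrep s 1.

Lemma tm_below s : below (tm s) s.
Proof. exact: lrep_below. Qed.

Lemma tm_neq0 s : tm s != 0.
Proof.
apply/eqP => /laurentP/(_ s); rewrite /tm /= ltxx subrr coef1 /=.
exact/eqP/oner_neq0.
Qed.

Lemma tmN s : tm (- s) * tm s = 1.
Proof.
apply/laurentP; apply: (@eq_below _ _ _ (- s + s)).
- by apply: conv_below; exact: tm_below.
- by rewrite addNr; exact: lone_below.
move=> i; rewrite [LHS](convE (@tm_below (- s)) (@tm_below s) (leqnn i)).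
have t u : forall j, (j <= i)%N -> (trunc (tm u) u i)`_j = (1 : {poly k})`_j.
  move=> j ji; rewrite coef_trunc//= ifF; last by lia.
  by congr (_`_ _); lia.
rewrite (coefM_eql _ (t (- s))) (coefM_eqr _ (t s)) mul1r coef1 addNr add0r.
by rewrite /= /lone_coef; congr (nat_of_bool _)%:R; lia.
Qed.

Definition pbelow a (f : {poly laurent k}) := forall i, below f`_i a.

Lemma pbelowD a f g : pbelow a f -> pbelow a g -> pbelow a (f + g).
Proof. by move=> fa ga i; rewrite coefD; exact: belowD. Qed.

Lemma pbelowN a f : pbelow a f -> pbelow a (- f).
Proof. by move=> fa i; rewrite coefN; exact: belowN. Qed.

Lemma pbelow_sum a I (r : seq I) (P : pred I) (F : I -> {poly laurent k}) :
  (forall i, P i -> pbelow a (F i)) -> pbelow a (\sum_(i <- r | P i) F i).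
Proof.
move=> Fa; elim/big_rec: _ => [i|i f Pi fa]; first by rewrite coef0; exact: below0.
exact: pbelowD (Fa _ Pi) fa.
Qed.

Lemma pbelowM a b f g : pbelow a f -> pbelow b g -> pbelow (a + b) (f * g).
Proof.
move=> fa gb i; rewrite coefM; elim/big_rec: _ => [|j x _ xab]; first exact: below0.
by apply: belowD => //; exact: belowM.
Qed.

Lemma pbelow_prodB a I (r : seq I) (F G : I -> {poly laurent k}) :
  (forall i, pbelow 0 (F i)) -> (forall i, pbelow 0 (G i)) ->
  (forall i, pbelow a (F i - G i)) ->
  [/\ pbelow 0 (\prod_(i <- r) F i), pbelow 0 (\prod_(i <- r) G i) &
      pbelow a (\prod_(i <- r) F i - \prod_(i <- r) G i)].
Proof.
move=> F0 G0 FG; elim: r => [|i r [Fr Gr FGr]].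
  have p1 : pbelow 0 1.
    move=> i; rewrite coef1.
    by case: (i == 0%N); [exact: lone_below|exact: below0].
  by rewrite !big_nil subrr; split => // i; rewrite coef0; exact: below0.
rewrite !big_cons; split; rewrite -?[X in pbelow X _]/(0 : int).
- by rewrite -[0]addr0; exact: pbelowM.
- by rewrite -[0]addr0; exact: pbelowM.
set f := \prod_(j <- r) F j; set g := \prod_(j <- r) G j.
have -> : F i * f - G i * g = (F i - G i) * f + G i * (f - g) by ring.
apply: pbelowD; first by rewrite -[a]addr0; exact: pbelowM.
by rewrite -[a]add0r; exact: pbelowM.
Qed.

Lemma pbelow_detB a n (A B : 'M[{poly laurent k}]_n) :
  (forall i j, pbelow 0 (A i j)) -> (forall i j, pbelow 0 (B i j)) ->
  (forall i j, pbelow a (A i j - B i j)) ->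
  pbelow 0 (\det A) /\ pbelow a (\det A - \det B).
Proof.
move=> A0 B0 AB.
have H (s : 'S_n) := @pbelow_prodB a _ (index_enum 'I_n) (fun i => A i (s i))
  (fun i => B i (s i)) (fun i => A0 _ _) (fun i => B0 _ _) (fun i => AB _ _).
have sg b (e : bool) f : pbelow b f -> pbelow b ((-1) ^+ e * f).
  by case: e => fb; rewrite ?expr1 ?expr0 ?mulN1r ?mul1r//; exact: pbelowN.
split.
  by apply: pbelow_sum => s _; apply: sg; have [] := H s.
rewrite /determinant -sumrB; apply: pbelow_sum => s _.
by rewrite -mulrBr; apply: sg; have [] := H s.
Qed.
End Emb.

Section Chevalley.
Variables (k : fieldType) (n : nat).
Local Notation V := 'M[laurent k]_n.
Implicit Types (X Y : V).

Lemma box_char_polyB a X Y : box 0 X -> box 0 Y -> box a (X - Y) ->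
  pbelow 0 (char_poly X) /\ pbelow a (char_poly X - char_poly Y).
Proof.
have cp Z i j : box 0 Z -> pbelow 0 (char_poly_mx Z i j).
  move=> Z0 l; rewrite !mxE coefB coefMn coefX coefC.
  apply: belowD; last by apply: belowN; case: ifP => _; [exact: Z0|exact: below0].
  by case: (_ == _); case: (i == j); rewrite ?mulr1n ?mulr0n; [exact: lone_below|exact: below0..].
move=> X0 Y0 XY; apply: pbelow_detB => i j; [exact: cp|exact: cp|].
move=> l; rewrite !mxE.
have subB (u x y : {poly laurent k}) : u - x - (u - y) = y - x.
  by rewrite opprB [LHS]addrC addrA subrK.
rewrite subB -polyCB coefC.
case: ifP => _; last exact: below0.
by rewrite -opprB; apply: belowN; have := XY i j; rewrite !mxE.
Qed.

(** Homogeneity of degree n - i, written without division: the characteristic polynomial of a X is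
    a^n times that of X evaluated at 'X / a. *)
Lemma coef_char_polyZ (F : fieldType) (a : F) (X : 'M[F]_n) i : a != 0 ->
  a ^+ i * (char_poly (a *: X))`_i = a ^+ n * (char_poly X)`_i.
Proof.
move=> a0.
have -> : char_poly (a *: X) = (a ^+ n)%:P * (char_poly X \Po (a^-1 *: 'X)).
  rewrite /char_poly; have -> : char_poly_mx (a *: X) =
      a%:P *: map_mx (comp_poly (a^-1 *: 'X)) (char_poly_mx X).
    apply/matrixP => r s; rewrite !mxE rmorphB rmorphMn /= comp_polyX comp_polyC.
    by rewrite mulrBr mulrnAr mul_polyC scalerA divff// scale1r polyCM.
  by rewrite detZ det_map_mx polyC_exp.
rewrite coefCM mulrCA; congr (_ * _).
rewrite comp_polyE coef_sum; set P := char_poly X.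
rewrite (eq_bigr (fun j : 'I_(size P) => if i == j :> nat then P`_j * a^-1 ^+ j else 0)).
  have [iP|Pi] := ltnP i (size P); last first.
    rewrite nth_default// big1 ?mulr0// => j _; case: eqP => // ij.
    by have := ltn_ord j; rewrite -ij ltnNge Pi.
  rewrite (bigD1 (Ordinal iP))//= eqxx big1 => [|j ji].
    by rewrite addr0 mulrCA -exprMn divff// expr1n mulr1.
  by case: eqP => // ij; case/eqP: ji; exact/val_inj.
move=> j _; rewrite coefZ exprZn coefZ coefXn; case: eqP; by rewrite ?mulr1 ?mulr0.
Qed.

Lemma below_tmX s j : below (tm k s ^+ j) (s * j%:Z).
Proof.
elim: j => [|j IH]; first by rewrite mulr0 expr0; exact: lone_below.
by rewrite exprS -addn1 PoszD mulrDr mulr1 addrC; apply: belowM => //; exact: tm_below.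
Qed.

Lemma box_tmZ s N X : box N X -> box (N + s) (tm k s *: X).
Proof.
by move=> XN i j; rewrite mxE addrC; apply: belowM; [exact: tm_below|exact: XN].
Qed.

(** When X is in [box (- s)], the matrix t^s X is integral; this formula transports estimates from
    the integral case to X. *)
Lemma chevalleyE s X i :
  chevalley X 0 i = tm k (- s) ^+ (n - i) * (char_poly (tm k s *: X))`_i.
Proof.
have ba j : tm k (- s) ^+ j * tm k s ^+ j = 1 by rewrite -exprMn tmN expr1n.
have /(congr1 (fun x => tm k (- s) ^+ n * x)) := coef_char_polyZ X i (tm_neq0 k s).
rewrite [in RHS]mulrA ba mul1r -{1}(subnK (ltnW (ltn_ord i))) exprD -mulrA.
by rewrite [X in _ * X]mulrA ba mul1r => ->; rewrite mxE.
Qed.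

Lemma box_chevalleyB s N X Y : 0 <= s ->
  box (- s) X -> box (- s) Y -> box N (X - Y) ->
  box (N - s * n%:Z) (chevalley X - chevalley Y).
Proof.
move=> s0 Xs Ys XYN i j.
have -> : (chevalley X - chevalley Y) i j = chevalley X 0 j - chevalley Y 0 j.
  by rewrite ord1 [LHS]mxE [X in _ + X]mxE.
have Z0 (Z : V) : box (- s) Z -> box 0 (tm k s *: Z).
  by move=> Zs; rewrite -(addNr s); exact: box_tmZ.
have XY : box (N + s) (tm k s *: X - tm k s *: Y).
  by rewrite -scalerBr; exact: box_tmZ.
have [_ /(_ j)] := box_char_polyB (Z0 _ Xs) (Z0 _ Ys) XY.
rewrite coefB => H; rewrite (chevalleyE s X j) (chevalleyE s Y j) -mulrBr.
apply: below_le (belowM (@below_tmX (- s) (n - j)%N) H).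
by have := ltn_ord j; nia.
Qed.

Lemma box_chevalley s X : 0 <= s -> box (- s) X -> box (- s * n%:Z) (chevalley X).
Proof.
move=> s0 Xs i j; rewrite ord1 (chevalleyE s).
have X0 : box 0 (tm k s *: X) by rewrite -(addNr s); exact: box_tmZ.
have XX : box 0 (tm k s *: X - tm k s *: X) by rewrite subrr; exact: box0.
have [/(_ j) H _] := box_char_polyB X0 X0 XX.
apply: below_le (belowM (@below_tmX (- s) (n - j)%N) H).
by have := ltn_ord j; nia.
Qed.

Lemma chevalley_open (A : set 'rV[laurent k]_n) : open A ->
  open (@chevalley (laurent k) n @^-1` A).
Proof.
rewrite !openE => oA X /oA/nbhs_boxP[N NA]; apply/nbhs_boxP.
have [s Xs] := box_ex X.
exists (N + s * n)%N => Y YX; apply: NA => /=.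
have -> : N%:Z = (N + s * n)%N%:Z - s%:Z * n%:Z by lia.
apply: box_chevalleyB => //.
rewrite -(subrK X Y); apply: boxD => //; apply: box_le YX; lia.
Qed.

Lemma measurable_chevalley :
  measurable_fun setT (@chevalley (laurent k) n : borel V -> borel 'rV[laurent k]_n).
Proof.
apply: (@measurability _ _ (borel V) (borel 'rV[laurent k]_n) setT _
  (@open 'rV[laurent k]_n)) => // _ [A oA <-].
by rewrite setTI; apply: sub_sigma_algebra; exact: chevalley_open.
Qed.
End Chevalley.

(** * The measure of the preimage of a ball *)

Section CosetBound.
Variables (k : finFieldType).
Local Notation q := (#|k|).

Lemma tmE s (x : laurent k) l : (tm k s * x) l = x (l - s).
Proof.
have [a xa] := laurent_below x.
have [la|al] := ltP l (s + a).
  by rewrite [LHS](conv_below (@tm_below k s) xa la) xa//; lia.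
have -> : l = s + a + (absz (l - (s + a))%R)%:Z by lia.
set j := absz _; rewrite [LHS](convE (@tm_below k s) xa (leqnn j)).
have t i : (i <= j)%N -> (trunc (tm k s) s j)`_i = (1 : {poly k})`_i.
  move=> ij; rewrite coef_trunc//= ifF; last by lia.
  by congr (_`_ _); lia.
rewrite (coefM_eql _ t) mul1r coef_trunc//; congr (x _); lia.
Qed.

Lemma lrep_ltrunc M s (x : laurent k) : below x s ->
  below (x - lrep s (val (ltrunc M s x))) (s + M.+1%:Z).
Proof.
move=> xs l lM /=; case: ltP => ls; first by rewrite xs// subr0.
rewrite coef_ltrunc; last by lia.
by rewrite (_ : s + _ = l) ?subrr//; lia.
Qed.

Lemma below_emb_in_qpoly M (p : {poly k}) :
  below (emb (val (in_qpoly 'X^(M.+1) p)) - emb p) M.+1%:Z.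
Proof.
rewrite -rmorphB; apply: below_emb_Xn; rewrite -in_qpoly_eq0.
by rewrite rmorphB subr_eq0; apply/eqP; exact: liftK.
Qed.

Lemma mtrunc_tmZ m n M s (X : 'M[laurent k]_(m, n)) :
  mtrunc M 0 (tm k s *: X) = mtrunc M (- s) X.
Proof.
apply/matrixP => i j; rewrite !mxE; congr in_qpoly; apply/polyP => l.
by rewrite !coef_poly; case: ifP => // _; rewrite tmE; congr (X i j _); lia.
Qed.

Variable n : nat.
Local Notation V := 'M[laurent k]_n.

(** The truncation of t^s X determines its characteristic polynomial modulo t^(M+1). Passing from X
    to t^s X multiplies the coefficients by nonnegative powers of t, so closeness to X1 is
    preserved. *)
Lemma near_row_mtrunc M N s (X X1 : V) : 0 <= s -> (N <= M.+1)%N ->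
  box (- s) X -> box (- s) X1 -> box N%:Z (chevalley X - chevalley X1) ->
  near_row N (fun i => val (ltrunc M 0 (char_poly (tm k s *: X1))`_i))
    (\row_(i < n) (char_poly (mtrunc M (- s) X))`_i).
Proof.
move=> s0 NM Xs X1s XX1; apply/forallP => i; rewrite mxE.
have Z0 (Z : V) : box (- s) Z -> box 0 (tm k s *: Z).
  by move=> Zs; rewrite -(addNr s); exact: box_tmZ.
have cp0 (Z : V) : box (- s) Z -> pbelow 0 (char_poly (tm k s *: Z)).
  move=> Zs; have ZZ : box 0 (tm k s *: Z - tm k s *: Z) by rewrite subrr; exact: box0.
  by have [] := box_char_polyB (Z0 _ Zs) (Z0 _ Zs) ZZ.
set r := mtrunc M (- s) X; set c := val (ltrunc M 0 _).
apply: below_emb; rewrite rmorphB.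
pose p := (char_poly (lmx r))`_i.
have rE : (char_poly r)`_i = in_qpoly 'X^(M.+1) p.
  by rewrite -[X in char_poly X]in_qpoly_lmx -map_char_poly coef_map.
have le : N%:Z <= M.+1%:Z by lia.
have H1 : below (emb (qlift ((char_poly r)`_i)) - emb p) N%:Z.
  by rewrite rE; apply: below_le le _; exact: below_emb_in_qpoly.
have H2 : below ((char_poly (tm k s *: X))`_i - emb p) N%:Z.
  have rX : box (0 + M.+1%:Z) (tm k s *: X - mrep 0 r).
    by rewrite /r -mtrunc_tmZ; apply: mrep_mtrunc; exact: Z0.
  have [_ /(_ i)] := box_char_polyB (Z0 _ Xs) (@box_mrep k n n M 0 r) rX.
  have -> : mrep 0 r = map_mx (@emb k) (lmx r) by apply/matrixP => a b; rewrite !mxE.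
  by rewrite -map_char_poly coefB coef_map add0r; apply: below_le.
have H3 : below ((char_poly (tm k s *: X))`_i - (char_poly (tm k s *: X1))`_i) N%:Z.
  have E (Z : V) : (char_poly (tm k s *: Z))`_i =
      tm k s ^+ (n - i) * chevalley Z 0 i.
    by rewrite (chevalleyE s) mulrA -exprMn mulrC [_ * tm k (- s)]mulrC tmN expr1n mulr1.
  rewrite [X in X - _]E [X in _ - X]E -mulrBr.
  have H : below (chevalley X 0 i - chevalley X1 0 i) N%:Z.
    have <- : (chevalley X - chevalley X1) 0 i = chevalley X 0 i - chevalley X1 0 i.
      by rewrite [LHS]mxE [X in _ + X]mxE.
    exact: XX1.
  by apply: below_le (belowM (@below_tmX k s (n - i)%N) H); nia.
have H4 : below ((char_poly (tm k s *: X1))`_i - emb c) N%:Z.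
  by apply: below_le le _; rewrite -[M.+1%:Z]add0r; apply: lrep_ltrunc; exact: cp0.
have tele (U : zmodType) (a b x y z : U) :
    a - z = (a - b) - (x - b) + (x - y) + (y - z).
  by rewrite opprB !addrA !subrK.
(* [H1] to [H4] link in turn the coefficient for the truncation, its lift p, those for t^s X and t^s
   X1, and the center c. *)
rewrite (tele _ _ (emb p) (char_poly (tm k s *: X))`_i (char_poly (tm k s *: X1))`_i).
by apply: belowD => //; apply: belowD => //; apply: belowD => //; exact: belowN.
Qed.

Definition chev_cst := ((1 + n * (n * 2)) ^ n.-1 + 3 ^ n)%N.

(* D = N * n is large enough for the error term 3 ^ n * q ^ - D.+1 of
   avg_near_char_poly to be O(q ^ - (N * n)). *)
Lemma card_near_char_poly N : (0 < n)%N -> exists M, (N <= M.+1)%N /\ forall c : nat -> {poly k},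
  (#|[set r : 'M[{poly %/ ('X^(M.+1) : {poly k})}]_n |
     near_row N c (\row_(i < n) (char_poly r)`_i)%R]%SET| * q ^ (N * n) <=
   chev_cst * q ^ (M.+1 * (n * n)))%N.
Proof.
(* With D = N * n, the three summands secure [n * D <= M.+1], [N <= M.+1] and [D <= M]. *)
move=> n0; exists (n * (N * n) + N + N * n)%N; split; first by lia.
move=> c; set M := (_ + _)%N; set S := [set r | _]%SET.
have := @avg_near_char_poly k M (N * n) n N c n0.
have -> : (N <= M.+1)%N by rewrite /M; lia.
have -> : (n * (N * n) <= M.+1)%N by rewrite /M; lia.
have -> : (N * n <= M)%N by rewrite /M; lia.
move=> /(_ isT isT isT); rewrite avg_bool card_mx card_Q -expnM => H.
have q0 := q_gt0 k; have qN : 0 < q%:R ^+ (N * n) :> rat by rewrite exprn_gt0.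
have qM : 0 < (q ^ (M.+1 * (n * n)))%:R :> rat by rewrite natrX exprn_gt0.
rewrite -(ler_nat rat) 2!natrM [(q ^ (N * n))%:R]natrX -ler_pdivlMr//.
rewrite -[leRHS]mulrA [X in _ * X]mulrC mulrA -ler_pdivrMr//; apply: le_trans H _.
rewrite /chev_cst natrD !natrX natrD !natrM mulrDl lerD2l ler_wpM2l ?exprn_ge0//.
by rewrite lef_pV2 ?posrE ?exprn_gt0// ler_eXn2l ?q_gt1.
Qed.

Variables (R : realType) (nu : {measure set (borel V) -> \bar R}).
Hypothesis hnu : is_haar nu.

(** Fix an element X1 of the set, if any. The truncations of all elements have a characteristic
    polynomial close to the one of t^s X1 ([near_row_mtrunc]); the number of such truncations times
    the mass of a coset gives the bound. *)
Lemma haar_chevalley_coset s (N : nat) (f : 'rV[laurent k]_n) : (0 < n)%N -> 0 <= s ->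
  (nu (box (- s) `&` (@chevalley (laurent k) n @^-1` [set Y | box N%:Z (Y - f)%R])) *
   (q ^ (N * n))%:R%:E <= chev_cst%:R%:E * nu (box (- s)))%E.
Proof.
move=> n0 s0; set A := _ `&` _.
have [->|/set0P[X1 [X1s X1f]]] := eqVneq A set0.
  by rewrite measure0 mul0e mule_ge0// lee_fin.
have [M [NM HM]] := card_near_char_poly N n0.
pose c := fun i => val (ltrunc M 0 (char_poly (tm k s *: X1))`_i).
pose S := [set r : 'M[{poly %/ ('X^(M.+1) : {poly k})}]_n |
     near_row N c (\row_(i < n) (char_poly r)`_i)]%SET.
have mA : measurable (A : set (borel V)).
  apply: measurableI; first exact: measurable_box.
  rewrite -[X in measurable X]setTI; apply: measurable_chevalley => //.
  by apply: box_inv_measurable; exact: box_inv_coset.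
have mS : measurable (box (- s) `&` [set X : V | mtrunc M (- s) X \in S] : set (borel V)).
  apply: (@box_inv_measurable _ _ _ (- s + M.+1%:Z)) => X Y [Xs XS] YX; split.
    by apply: box_inv_box Xs YX; lia.
  suff E : mtrunc M (- s) Y = mtrunc M (- s) X by rewrite /= E.
  apply: mtrunc_coset; rewrite -(subrK X Y) -addrA; apply: boxD => //.
  exact: mrep_mtrunc.
have AS : (nu A <= nu (box (- s) `&` [set X : V | mtrunc M (- s) X \in S]))%E.
  apply: le_measure; rewrite ?inE// => X [Xs Xf]; split => //=; rewrite inE.
  have XX1 : box N%:Z (chevalley X - chevalley X1).
    have -> : chevalley X - chevalley X1 = (chevalley X - f) - (chevalley X1 - f).
      by rewrite opprB addrA subrK.
    exact: (boxB Xf X1f).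
  exact: (near_row_mtrunc s0 NM Xs X1s XX1).
apply: le_trans (lee_wpmul2r _ AS) _; first by rewrite lee_fin.
rewrite haar_mtrunc// (haar_box_split hnu M (- s)).
have fin := haar_box_fin_num hnu (- s + M.+1%:Z).
rewrite -(fineK fin) -!EFinM lee_fin mulrAC mulrA ler_wpM2r ?fine_ge0//.
by rewrite -!natrM ler_nat; exact: HM.
Qed.
End CosetBound.

(** * From balls to Borel sets *)

Section PushRestrict.
Context d1 d2 (T1 : measurableType d1) (T2 : measurableType d2) (R : realType).
Variables (m : {measure set T1 -> \bar R}) (f : T1 -> T2) (D : set T1).
Hypotheses (mf : measurable_fun setT f) (mD : measurable D).

Lemma push_restrict_ex : exists m' : {measure set T2 -> \bar R},
  forall A, m' A = m (f @^-1` A `&` D).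
Proof.
pose F (A : set T2) := m (f @^-1` A `&` D).
have mfA A : measurable A -> measurable (f @^-1` A).
  by move=> mA; rewrite -[X in measurable X]setTI; exact: mf.
have F0 : F set0 = 0%E by rewrite /F preimage_set0 set0I measure0.
have Fge0 A : (0 <= F A)%E by exact: measure_ge0.
have Fs : semi_sigma_additive F.
  move=> G mG tG mUG; rewrite /F preimage_bigcup setI_bigcupl.
  apply: measure_semi_sigma_additive.
  - by move=> n; apply: measurableI => //; exact: mfA.
  - apply/trivIsetP => i j _ _ ij; rewrite setIACA -preimage_setI.
    by move/trivIsetP : tG => /(_ _ _ _ _ ij) ->//; rewrite preimage_set0 set0I.
  - by rewrite -setI_bigcupl -preimage_bigcup; apply: measurableI => //; exact: mfA.
pose m' : {measure set T2 -> \bar R} :=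
  HB.pack_for {measure set T2 -> \bar R} F (isMeasure.Build _ _ _ F F0 Fge0 Fs).
by exists m'.
Qed.
End PushRestrict.

Section Approximation.
Context d (T : measurableType d) (R : realType).
Variables (s : {measure set T -> \bar R}) (A0 : set (set T)).
Hypotheses (sT : (s setT < +oo)%E) (mA0 : A0 `<=` measurable)
  (A00 : A0 set0) (A0C : forall A, A0 A -> A0 (~` A))
  (A0U : forall A B, A0 A -> A0 B -> A0 (A `|` B)).

Let sfin A : measurable A -> (s A < +oo)%E.
Proof.
by move=> mA; apply: le_lt_trans sT; apply: le_measure; rewrite ?inE//.
Qed.

Let approximable : set (set T) := [set A | measurable A /\
  forall e : R, 0 < e -> exists2 B, A0 B & (s (A `\` B) + s (B `\` A) < e%:E)%E].

Let approximableU A B : approximable A -> approximable B -> approximable (A `|` B).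
Proof.
move=> [mA hA] [mB hB]; split; first exact: measurableU.
move=> e e0; have e2 : 0 < e / 2 by rewrite divr_gt0.
have [A' A0A' sA] := hA _ e2; have [B' A0B' sB] := hB _ e2.
exists (A' `|` B'); first exact: A0U.
have mA' := mA0 A0A'; have mB' := mA0 A0B'.
apply: (@le_lt_trans _ _ ((s (A `\` A') + s (A' `\` A)) +
    (s (B `\` B') + s (B' `\` B)))%E); last first.
  by rewrite [e in ltRHS](splitr e) EFinD; exact: lteD.
rewrite addeACA; apply: leeD.
  apply: (@le_trans _ _ (s ((A `\` A') `|` (B `\` B')))); last first.
    by apply: measureU2; exact: measurableD.
  apply: le_measure; rewrite ?inE; [by apply: measurableD; exact: measurableU|
    by apply: measurableU; exact: measurableD|].
  by move=> x [[Ax|Bx] /not_orP[nA nB]]; [left|right].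
apply: (@le_trans _ _ (s ((A' `\` A) `|` (B' `\` B)))); last first.
  by apply: measureU2; exact: measurableD.
apply: le_measure; rewrite ?inE; [by apply: measurableD; exact: measurableU|
  by apply: measurableU; exact: measurableD|].
by move=> x [[Ax|Bx] /not_orP[nA nB]]; [left|right].
Qed.

(** For a finite measure, the sets that the algebra [A0] approximates form a sigma-algebra. *)
Lemma sigma_algebra_approx A : <<s A0 >> A -> forall e : R, 0 < e ->
  exists2 B, A0 B & (s (A `\` B) + s (B `\` A) < e%:E)%E.
Proof.
suff : <<s A0 >> `<=` approximable by move=> h /h[].
apply: smallest_sub; last first.
  move=> B A0B; split; first exact: mA0.
  by move=> e e0; exists B => //; rewrite setDv measure0 adde0 lte_fin.
have ap0 : approximable set0.
  split => // e e0; exists set0 => //.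
  by rewrite setDv measure0 adde0 lte_fin.
split => // [B [mB hB]|F apF].
  split; first by rewrite setTD; exact: measurableC.
  move=> e e0; have [B' A0B' sB] := hB _ e0; exists (~` B'); first exact: A0C.
  have DC C C' : ~` C `\` ~` C' = C' `\` C :> set T by rewrite !setDE setCK setIC.
  by rewrite setTD !DC addeC.
have mF n : measurable (F n) by have [] := apF n.
have mUF : measurable (\bigcup_n F n) by exact: bigcupT_measurable.
split => // e e0; have e2 : 0 < e / 2 by rewrite divr_gt0.
(* The countable union is within e / 2 of some partial union, by continuity of the finite measure,
   and this one is within e / 2 of a member of [A0]. *)
pose H n := \big[setU/set0]_(i < n) F i.
have apH n : approximable (H n).
  rewrite /H; elim: n => [|n IH]; first by rewrite big_ord0.
  by rewrite big_ord_recr /=; exact: approximableU.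
have mH n : measurable (H n) by have [] := apH n.
have cvH : s (\bigcup_n F n `\` H n) @[n --> \oo] --> 0%E.
  have I0 : \bigcap_n (\bigcup_n F n `\` H n) = set0.
    rewrite -subset0 => x xI; have [[n _ Fn] _] := xI 0%N I.
    have [_] := xI n.+1 I; apply; rewrite /H big_ord_recr /=; by right.
  rewrite -(measure0 s) -I0; apply: nonincreasing_cvg_mu.
  - by apply: sfin; exact: measurableD.
  - by move=> n; exact: measurableD.
  - by rewrite I0.
  - move=> n p np; apply/subsetPset; apply: setDS.
    rewrite /H -!bigcup_mkord; apply: bigcup_subset => i /= ip.
    exact: leq_trans ip np.
have [n /= sn] : exists n, (s (\bigcup_n F n `\` H n) < (e / 2)%:E)%E.
  have : nbhs (0%E : \bar R) [set x | (x < (e / 2)%:E)%E].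
    by apply: open_nbhs_nbhs; split; [exact: open_ereal_lt_ereal|rewrite /= lte_fin].
  move=> /cvH[n _ nP]; exists n; exact: (nP n (leqnn n)).
have [_ /(_ _ e2)[B A0B sB]] := apH n; exists B => //; have mB := mA0 A0B.
rewrite [e in ltRHS](splitr e) EFinD.
apply: (@le_lt_trans _ _ (s (\bigcup_n F n `\` H n) +
    (s (H n `\` B) + s (B `\` H n)))%E); last first.
  exact: lteD.
rewrite addeA; apply: leeD.
  apply: (@le_trans _ _ (s ((\bigcup_n F n `\` H n) `|` (H n `\` B)))); last first.
    by apply: measureU2; exact: measurableD.
  apply: le_measure; rewrite ?inE; [exact: measurableD|
    by apply: measurableU; exact: measurableD|].
  by move=> x [xF nB]; have [xH|nH] := pselect (H n x); [right|left].
apply: le_measure; rewrite ?inE; [exact: measurableD..|].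
move=> x [Bx nF]; split => //; rewrite /H -bigcup_mkord => -[i _ Fi].
by apply: nF; exists i.
Qed.
End Approximation.

(** Approximation of A by B for the sum of both measures gives m1 A <= m1 B + delta <= K m2 B +
    delta <= K m2 A + (1 + K) delta, whence the choice delta = e / (1 + K). *)
Lemma le_measure_approx d (T : measurableType d) (R : realType)
    (m1 m2 : {measure set T -> \bar R}) (A0 : set (set T)) (K : R) :
  (m1 setT < +oo)%E -> (m2 setT < +oo)%E -> A0 `<=` measurable ->
  A0 set0 -> (forall A, A0 A -> A0 (~` A)) ->
  (forall A B, A0 A -> A0 B -> A0 (A `|` B)) ->
  measurable `<=` <<s A0 >> -> 0 <= K ->
  (forall B, A0 B -> (m1 B <= K%:E * m2 B)%E) ->
  forall A, measurable A -> (m1 A <= K%:E * m2 A)%E.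
Proof.
move=> m1T m2T mA0 A00 A0C A0U mgen K0 H A mA.
apply/lee_addgt0Pr => e e0; have K1 : 0 < 1 + K by rewrite ltr_pwDl.
have e1 : 0 < e / (1 + K) by rewrite divr_gt0.
pose s : {measure set T -> \bar R} := measure_add m1 m2.
have sE C : s C = (m1 C + m2 C)%E by exact: measure_addE.
have sT : (s setT < +oo)%E by rewrite sE lte_add_pinfty.
have [B A0B] := sigma_algebra_approx sT mA0 A00 A0C A0U (mgen _ mA) e1.
rewrite !sE => sB; have mB := mA0 _ A0B.
have sub (m : {measure set T -> \bar R}) C C' : measurable C -> measurable C' ->
    (m C <= m C' + m (C `\` C'))%E.
  move=> mC mC'; apply: (@le_trans _ _ (m (C' `|` (C `\` C')))).
    apply: le_measure; rewrite ?inE//; first by apply: measurableU => //; exact: measurableD.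
    by move=> x Cx; have [?|?] := pselect (C' x); [left|right].
  by apply: measureU2 => //; exact: measurableD.
have fin1 C : measurable C -> m1 C \is a fin_num.
  move=> mC; rewrite ge0_fin_numE//; apply: le_lt_trans m1T.
  by apply: le_measure; rewrite ?inE.
have fin2 C : measurable C -> m2 C \is a fin_num.
  move=> mC; rewrite ge0_fin_numE//; apply: le_lt_trans m2T.
  by apply: le_measure; rewrite ?inE.
have mAB : measurable (A `\` B) by exact: measurableD.
have mBA : measurable (B `\` A) by exact: measurableD.
have h1 := sub m1 _ _ mA mB; have h2 := sub m2 _ _ mB mA; have h3 := H _ A0B.
move: sB h1 h2 h3; rewrite -(fineK (fin1 _ mA)) -(fineK (fin2 _ mA)).
rewrite -(fineK (fin1 _ mB)) -(fineK (fin2 _ mB)).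
rewrite -(fineK (fin1 _ mAB)) -(fineK (fin2 _ mAB)).
rewrite -(fineK (fin1 _ mBA)) -(fineK (fin2 _ mBA)).
have := fine_ge0 (measure_ge0 m1 (A `\` B)); have := fine_ge0 (measure_ge0 m2 (B `\` A)).
have := fine_ge0 (measure_ge0 m1 (B `\` A)); have := fine_ge0 (measure_ge0 m2 (A `\` B)).
move: (fine _) (fine _) (fine _) (fine _) (fine _) (fine _) (fine _) (fine _).
move=> u1 u2 v1 v2 v3 v4 v5 v6 ? ? ? ?.
rewrite -!EFinM -!EFinD !lee_fin lte_fin ltr_pdivlMr// => hs h1 h2 h3.
by have := ler_wpM2l K0 h2; nra.
Qed.

Section HaarComparison.
Variables (R : realType) (k : finFieldType) (m n : nat).
Local Notation V := 'M[laurent k]_(m, n).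
Implicit Types (s : int) (N : nat).

Definition box_invs : set (set V) := [set A | exists N, box_inv N%:Z A].

Lemma box_invs0 : box_invs set0.
Proof. by exists 0%N. Qed.

Lemma box_invsC A : box_invs A -> box_invs (~` A).
Proof.
move=> [N AN]; exists N => X Y nAX YX /= AY; apply: nAX; apply: AN AY _.
by rewrite -opprB; exact: boxN.
Qed.

Lemma box_invsU A B : box_invs A -> box_invs B -> box_invs (A `|` B).
Proof.
move=> [N AN] [N' BN]; exists (N + N')%N => X Y [AX|BX] YX.
  by left; apply: AN AX _; apply: box_le YX; lia.
by right; apply: BN BX _; apply: box_le YX; lia.
Qed.

Lemma box_invs_measurable : box_invs `<=` @measurable _ (borel V).
Proof. by move=> A [N /box_inv_measurable]. Qed.

(** An open set is the union over N of its sets of points whose whole coset of [box N] it contains,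
    and each of these is invariant under [box N]. *)
Lemma measurable_box_invs : @measurable _ (borel V) `<=` <<s box_invs >>.
Proof.
apply: smallest_sub; first exact: smallest_sigma_algebra.
move=> U; rewrite openE => oU.
pose F N := [set X : V | forall Y, box N%:Z (Y - X) -> U Y].
have -> : U = \bigcup_N F N.
  apply/seteqP; split => [X /oU/nbhs_boxP[N NU]|X [N _ NU]]; first by exists N.
  by apply: NU; rewrite subrr; exact: box0.
apply: (@bigcupT_measurable _ (g_sigma_algebraType box_invs)) => N.
apply: sub_sigma_algebra; exists N => X Y FX YX Z ZY; apply: FX.
by rewrite -(subrK Y Z) -addrA; exact: boxD.
Qed.

(** The intersection is a finite disjoint union of cosets of one small box: the hypothesis applies
    to each coset, and [nu] gives them equal masses. *)
Lemma le_haar_box_inv (nu m1 : {measure set (borel V) -> \bar R}) s K :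
  is_haar nu -> 0 <= K ->
  (forall N X, (m1 [set Y : V | box N%:Z (Y - X)%R] <= K%:E * nu (box N%:Z))%E) ->
  forall A, box_invs A -> (m1 (A `&` box s) <= K%:E * nu (A `&` box s))%E.
Proof.
move=> hnu K0 H A [N AN]; pose M := (absz s + N)%N; pose N' := absz (s + M.+1%:Z)%R.
have NE : s + M.+1%:Z = N'%:Z by rewrite /N' /M; lia.
pose S := [set r : 'M[{poly %/ ('X^(M.+1) : {poly k})}]_(m, n) | mrep s r \in A]%SET.
have AE : A `&` box s = box s `&` [set X : V | mtrunc M s X \in S].
  rewrite setIC; apply/seteqP; split => X [Xs XA]; split => //=.
    rewrite inE; apply/mem_set; apply: AN XA _; rewrite -opprB; apply: boxN.
    by apply: box_le (@mrep_mtrunc k m n M s X Xs); rewrite NE /N' /M; lia.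
  move: XA; rewrite /= inE => /set_mem XA; apply: AN XA _.
  by apply: box_le (@mrep_mtrunc k m n M s X Xs); rewrite NE /N' /M; lia.
rewrite AE (haar_mtrunc hnu) NE.
rewrite mtrunc_preimageE NE measure_fin_bigcup//; first last.
- by move=> r _; apply: box_inv_measurable; exact: box_inv_coset.
- move=> r r' _ _ [X []]; rewrite -NE => Xr Xr'.
  by rewrite -(mtrunc_coset Xr) -(mtrunc_coset Xr').
rewrite -fsbig_seq ?enum_uniq//.
apply: (@le_trans _ _ (\sum_(r <- enum S) (K%:E * nu (box N'%:Z)))%E).
  by apply: lee_sum => r _; exact: H.
rewrite -(fineK (haar_box_fin_num hnu _)) -!EFinM sumEFin big_const_seq iter_addr_0.
by rewrite count_predT -cardE lee_fin mulr_natl mulrnAr lexx.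
Qed.
End HaarComparison.

(** * A Haar measure on rows, and domination of the pushforward *)

Section HaarRow.
Variables (R : realType) (k : finFieldType) (m n : nat).
Local Notation V := 'M[laurent k]_(m.+1, n).

Lemma row0_open (A : set 'rV[laurent k]_n) : open A -> open (row 0 @^-1` A : set V).
Proof.
rewrite !openE => oA X /oA/nbhs_boxP[N NA].
apply/nbhs_boxP; exists N => Y YX; apply: NA => i j.
by rewrite -raddfB mxE; exact: YX.
Qed.

Lemma measurable_row0 : measurable_fun setT (row 0 : borel V -> borel 'rV[laurent k]_n).
Proof.
apply: (@measurability _ _ (borel V) (borel 'rV[laurent k]_n) setT _
  (@open 'rV[laurent k]_n)) => // _ [A oA <-].
by rewrite setTI; apply: sub_sigma_algebra; exact: row0_open.
Qed.

(** The measure [nu] is restricted to the matrices whose rows other than the first are integral,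
    then pushed forward along the first row. Translations of rows lift to translations preserving
    [D], and the part of [D] above a compact set lies in a box. *)
Lemma haar_row_ex (nu : {measure set (borel V) -> \bar R}) : is_haar nu ->
  exists nu' : {measure set (borel 'rV[laurent k]_n) -> \bar R}, is_haar nu'.
Proof.
move=> hnu; have [hT hK _] := hnu.
pose D : set V := [set X : V | forall i j, i != 0 -> below (X i j) 0].
have Dinv : box_inv 0 D.
  move=> X Y DX YX i j i0; rewrite -(subrK X Y) mxE.
  by apply: belowD; [exact: YX|exact: DX].
have mD : measurable (D : set (borel V)) by exact: box_inv_measurable Dinv.
have [nu' nu'E] := push_restrict_ex nu measurable_row0 mD.
have b0D : box 0 `<=` D by move=> X X0 i j _; exact: X0.
exists nu'; split.
- move=> v A mA; rewrite !nu'E.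
  pose w : V := \matrix_(i, j) if i == 0 then v 0 j else 0.
  have w0 : row 0 w = v by apply/rowP => j; rewrite !mxE eqxx.
  have Dw X : D (w + X) <-> D X.
    by split => DX i j i0; have := DX i j i0; rewrite !mxE (negbTE i0) add0r.
  rewrite -[RHS](hT w); last first.
    apply: measurableI => //; rewrite -[X in measurable X]setTI.
    exact: measurable_row0.
  congr (nu _); apply/seteqP; split => [X [[x Ax /= xX] DX]|_ [X [AX DX] <-]].
    exists (X - w); last by rewrite addrC subrK.
    split; last by apply/Dw; rewrite addrC subrK.
    by rewrite /= raddfB /= w0 -xX addrC addKr.
  split; last exact/Dw.
  by exists (row 0 X) => //; rewrite raddfD /= w0.
- move=> K cK; have [N KN] := compact_sub_box cK.
  apply: (@le_lt_trans _ _ (nu (box (- N%:Z)))); last exact: haar_box_fin.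
  rewrite nu'E; apply: le_measure; rewrite ?inE.
  + apply: measurableI => //; rewrite -[X in measurable X]setTI.
    by apply: measurable_row0 => //; exact: compact_measurable.
  + exact: measurable_box.
  + move=> X [/KN XN DX] i j; have [->|i0] := eqVneq i 0.
      by have := XN 0 j; rewrite mxE.
    by apply: below_le (DX i j i0); lia.
- rewrite nu'E preimage_setT setTI gt_eqF//.
  apply: lt_le_trans (haar_box_gt0 hnu 0) _.
  by apply: le_measure; rewrite ?inE//; exact: measurable_box.
Qed.
End HaarRow.

Section ChevalleyBound.
Variables (R : realType) (k : finFieldType) (n : nat).
Local Notation V := 'M[laurent k]_n.
Variables (nu : {measure set (borel V) -> \bar R})
  (nu' : {measure set (borel 'rV[laurent k]_n) -> \bar R}).
Hypotheses (hnu : is_haar nu) (hnu' : is_haar nu') (n0 : (0 < n)%N).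

(** For cosets of [box N] this is [haar_chevalley_coset] combined with nu'(box 0) = q^(N n) nu'(box
    N), which explains K. Unions of cosets follow by additivity, and Borel sets by approximation. *)
Lemma le_chevalley_haar s : 0 <= s -> exists2 K : R, 0 <= K &
  forall A : set 'rV[laurent k]_n, measurable (A : set (borel _)) ->
  (nu (@chevalley (laurent k) n @^-1` A `&` box (- s)) <= K%:E * nu' A)%E.
Proof.
move=> s0; pose B0 : set 'rV[laurent k]_n := box (- s * n%:Z).
pose K := (chev_cst n)%:R * fine (nu (box (- s))) / fine (nu' (box 0)).
have b0 : 0 < fine (nu' (box 0)).
  by apply: fine_gt0; rewrite (haar_box_gt0 hnu') (haar_box_fin hnu').
have K0 : 0 <= K by rewrite !mulr_ge0 ?invr_ge0 ?fine_ge0.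
exists K => // A mA.
have mB0 : measurable (B0 : set (borel _)) by exact: measurable_box.
have mbs : measurable (box (- s) : set (borel V)) by exact: measurable_box.
have [m1 m1E] := push_restrict_ex nu (@measurable_chevalley k n) mbs.
have [m2 m2E] := push_restrict_ex nu' (@measurable_id _ (borel 'rV[laurent k]_n) setT) mB0.
have mT1 : (m1 setT < +oo)%E by rewrite m1E preimage_setT setTI haar_box_fin.
have mT2 : (m2 setT < +oo)%E by rewrite m2E preimage_setT setTI haar_box_fin.
(* The image of [box (- s)] lies in [B0], so both measures live on [B0], where they are finite. *)
have m1B B : m1 B = m1 (B `&` B0).
  rewrite !m1E; congr (nu _); apply/seteqP; split => X [/= XB Xs]; split => //.
    by split => //; exact: box_chevalley.
  by have [] := XB.
have := le_measure_approx mT1 mT2 (@box_invs_measurable k 1 n) (@box_invs0 k 1 n)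
  (@box_invsC k 1 n) (@box_invsU k 1 n) (@measurable_box_invs k 1 n) K0 _ mA.
rewrite m1E => h; apply: le_trans (h _) _ => [B iB|].
  rewrite m1B m2E preimage_id; apply: (@le_haar_box_inv R k 1 n nu' m1 _ K hnu' K0) => // N f.
  have := haar_chevalley_coset hnu N f n0 s0.
  rewrite setIC -m1E; set P := m1 _.
  have bE : nu' (box 0) = ((#|k| ^ (N * n))%:R%:E * nu' (box N%:Z))%E.
    case: (N) => [|M]; first by rewrite mul0n expn0 mul1e.
    by rewrite (haar_box_split hnu' M) mul1n add0r.
  have Pfin : P \is a fin_num.
    rewrite ge0_fin_numE; last exact: measure_ge0.
    apply: (@le_lt_trans _ _ (m1 setT)); last exact: mT1.
    apply: le_measure; rewrite ?inE//.
    by apply: box_inv_measurable; exact: box_inv_coset.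
  have b0' := b0; move: b0'; rewrite /K.
  have fN := haar_box_fin_num hnu' N%:Z; have fs := haar_box_fin_num hnu (- s).
  rewrite -(fineK Pfin) -(fineK fN) -(fineK fs) bE fineM// -!EFinM !lee_fin /=.
  have q0 : 0 < (#|k| ^ (N * n))%:R :> R.
    by rewrite ltr0n expn_gt0 (ltnW (card_finNzRing_gt1 k)).
  move: (fine P) (fine (nu' _)) (_ ^ _)%:R q0 => u v w q0 h1 h2.
  have v0 : 0 < v by move: h1; rewrite pmulr_rgt0.
  by rewrite invfM mulrA divfK ?gt_eqF// ler_pdivlMr.
rewrite lee_wpmul2l ?lee_fin// m2E; apply: le_measure; rewrite ?inE//.
exact: measurableI.
Qed.
End ChevalleyBound.

(** * Bounded densities *)

Section BoundedDensity.
Context d (T : measurableType d) (R : realType).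
Implicit Types (mu : {measure set T -> \bar R}) (g : T -> R) (C : R).

(** Where g is at least C + 1/(i+1), integration bounds (C + 1/(i+1)) times the mass by C times the
    mass, which is finite, hence zero; these sets exhaust the one in question. *)
Lemma measure_gt_eq0 mu g C : mu.-integrable setT (EFin \o g) -> 0 <= C ->
  (forall A, measurable A -> (\int[mu]_(x in A) (g x)%:E <= C%:E * mu A)%E) ->
  mu [set x | C < g x] = 0%E.
Proof.
move=> intg C0 gC.
have mg : measurable_fun setT g by apply/measurable_EFinP; exact: measurable_int intg.
pose e (i : nat) : R := C + i.+1%:R^-1; pose E i := [set x | e i <= g x].
have mE i : measurable (E i).
  have -> : E i = setT `&` g @^-1` `[e i, +oo[.
    by rewrite setTI; apply/seteqP; split => x; rewrite /E /= in_itv /= andbT.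
  by apply: mg => //; exact: measurable_itv.
have E0 i : mu (E i) = 0%E.
  have e0 : 0 < e i by rewrite ltr_wpDl ?invr_gt0.
  have h1 : ((e i)%:E * mu (E i) <= \int[mu]_(x in E i) (g x)%:E)%E.
    rewrite -integral_cst//; apply: ge0_le_integral => //.
    - by move=> x _; exact: ltW.
    - by apply/measurable_EFinP; exact: measurable_funTS.
  have fi : (\int[mu]_(x in E i) (g x)%:E < +oo)%E.
    rewrite ltey_eq; apply/orP; left; apply: integrable_fin_num => //.
    exact: integrableS intg.
  have fE : mu (E i) \is a fin_num.
    rewrite ge0_fin_numE// ltNge leye_eq; apply/negP => /eqP Ey.
    by have := le_lt_trans h1 fi; rewrite Ey gt0_muley ?lte_fin// ltxx.
  move: (le_trans h1 (gC _ (mE i))) (fine_ge0 (measure_ge0 mu (E i))).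
  rewrite -(fineK fE) -!EFinM !lee_fin => h2 m0.
  have i0 : 0 < i.+1%:R^-1 :> R by rewrite invr_gt0.
  apply/eqP; rewrite eqe eq_le m0 andbT.
  by move: h2; rewrite /e mulrDl gerDl pmulr_rle0.
apply/eqP; rewrite eq_le measure_ge0 andbT.
have EE : [set x | C < g x] = \bigcup_i E i.
  apply/seteqP; split => [x /= Cx|x [i _]]; last first.
    by apply: lt_le_trans; rewrite ltrDl invr_gt0.
  have d0 : 0 < g x - C by rewrite subr_gt0.
  exists (Num.truncn (g x - C)^-1) => //; rewrite /E /= /e addrC -lerBrDr.
  rewrite invf_ple ?posrE//; first exact/ltW/truncnS_gt.
rewrite EE; apply: le_trans (measure_sigma_subadditive _ _ _ (fun=> id)) _ => //.
- exact: bigcupT_measurable.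
- by rewrite eseries0.
Qed.

(** The bound makes [la] absolutely continuous, and [measure_gt_eq0] for g and - g shows that its
    Radon-Nikodym density lies between - C and C almost everywhere. *)
Lemma bounded_density (mu : {sigma_finite_measure set T -> \bar R})
    (la : {charge set T -> \bar R}) C : 0 <= C ->
  (forall A, measurable A -> (`|la A| <= C%:E * mu A)%E) ->
  exists g, [/\ mu.-integrable setT (EFin \o g), (forall x, `|g x| <= C) &
    forall A, measurable A -> la A = (\int[mu]_(x in A) (g x)%:E)%E].
Proof.
move=> C0 laC.
have dom : la `<< mu.
  apply/null_content_dominatesP => A mA A0; apply/eqP.
  by rewrite -abse_eq0 eq_le abse_ge0 andbT -(mule0 C%:E) -A0 laC.
pose g x := fine (Radon_Nikodym la mu x).
have gE : EFin \o g = Radon_Nikodym la mu.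
  by apply/funext => x; rewrite /= fineK// Radon_Nikodym_fin_num.
have intg : mu.-integrable setT (EFin \o g) by rewrite gE; exact: Radon_Nikodym_integrable.
have lag A : measurable A -> la A = (\int[mu]_(x in A) (g x)%:E)%E.
  by move=> mA; rewrite (Radon_Nikodym_integral dom mA) -gE.
have mg : measurable_fun setT g by apply/measurable_EFinP; exact: measurable_int intg.
have intAg A : measurable A -> mu.-integrable A (EFin \o g).
  by move=> mA; exact: integrableS intg.
have N1 : mu [set x | C < g x] = 0%E.
  apply: measure_gt_eq0 => // A mA; rewrite -lag//.
  by apply: le_trans (laC _ mA); exact: lee_abs.
have intNg : mu.-integrable setT (EFin \o (fun x => - g x)).
  by rewrite (_ : EFin \o _ = -%E \o (EFin \o g))%E//; exact: integrableN.
have N2 : mu [set x | C < - g x] = 0%E.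
  apply: measure_gt_eq0 => // A mA; apply: le_trans (laC _ mA).
  under eq_integral do rewrite EFinN.
  rewrite integralN; last exact: (integrable_add_def mA (intAg _ mA)).
  by rewrite -lag// -abseN; exact: lee_abs.
have mgt u : measurable_fun setT u -> measurable [set x : T | C < u x].
  move=> mu'; have -> : [set x | C < u x] = setT `&` u @^-1` `]C, +oo[.
    by rewrite setTI; apply/seteqP; split => x; rewrite /= in_itv /= andbT.
  by apply: mu' => //; exact: measurable_itv.
have mN1 := mgt _ mg; have mN2 : measurable [set x | C < - g x].
  by apply: mgt; exact: measurableT_comp.
(* Clamping to [- C, C] changes g on a null set only and makes the bound hold at every point. *)
pose h x := Num.max (- C) (Num.min C (g x)).
have mh : measurable_fun setT h.
  by apply: measurable_maxr => //; exact: measurable_minr.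
have hC x : `|h x| <= C.
  rewrite ler_norml /h le_max lexx /= ge_max ge_min lexx /= andbT.
  by rewrite (le_trans _ C0)// oppr_le0.
have hg x : `|h x| <= `|g x|.
  rewrite /h; have [Cg|gC] := leP C (g x).
    rewrite (max_idPr _) ?ger0_norm// ?(le_trans C0)// (le_trans _ C0)// oppr_le0//.
  have [Cg|gC'] := leP (- C) (g x) => //.
  rewrite normrN ger0_norm// ler0_norm; first by rewrite lerNr ltW.
  by rewrite (le_trans (ltW gC'))// oppr_le0.
have aeE : ae_eq mu setT (EFin \o g) (EFin \o h).
  exists ([set x | C < g x] `|` [set x | C < - g x]); split.
  - exact: measurableU.
  - by rewrite measureU0.
  - move=> x /= nE; apply: contrapT => /not_orP[/negP + /negP]; rewrite -!leNgt => h1 h2.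
    apply: nE => _; congr _%:E; rewrite /h (min_idPr _)// (max_idPr _)//; lra.
exists h; split => //.
  apply: le_integrable intg => //; first exact/measurable_EFinP.
  by move=> x _; rewrite !lee_fin.
move=> A mA; rewrite lag//; apply: ae_eq_integral => //.
- by apply/measurable_EFinP; exact: measurable_funTS.
- by apply/measurable_EFinP; exact: measurable_funTS.
- by apply: filterS aeE => x /= xE _; exact: xE.
Qed.
End BoundedDensity.

Lemma push_charge_ex d1 d2 (T1 : measurableType d1) (T2 : measurableType d2)
    (R : realType) (nu : {measure set T1 -> \bar R}) (f : T1 -> T2)
    (h : T1 -> \bar R) :
  measurable_fun setT f -> nu.-integrable setT h ->
  exists la : {charge set T2 -> \bar R},
    forall A, la A = (\int[nu]_(x in f @^-1` A) h x)%E.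
Proof.
move=> mf inth; pose F (A : set T2) := induced_charge inth (f @^-1` A).
have mfA A : measurable A -> measurable (f @^-1` A).
  by move=> mA; rewrite -[X in measurable X]setTI; exact: mf.
have F0 : F set0 = 0%E by rewrite /F preimage_set0 charge0.
have Ffin A : measurable A -> F A \is a fin_num.
  by move=> mA; apply: fin_num_measure; exact: mfA.
have Fs : semi_sigma_additive F.
  move=> G mG tG mUG; rewrite /F preimage_bigcup.
  apply: charge_semi_sigma_additive => [i||]; first exact: mfA.
  - apply/trivIsetP => i j _ _ ij; rewrite -preimage_setI.
    by move/trivIsetP : tG => /(_ _ _ _ _ ij) ->//; rewrite preimage_set0.
  - by rewrite -preimage_bigcup; exact: mfA.
pose la : {charge set T2 -> \bar R} :=
  HB.pack_for (charge T2 R) F (isCharge.Build _ _ _ F F0 Ffin Fs).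
by exists la.
Qed.

Section SigmaFiniteDensity.
Context d (T : measurableType d) (R : realType).
Variables (mu : {measure set T -> \bar R}) (sf_mu : sigma_finite setT mu).

(* A copy of mu carrying sigma-finiteness, as Radon-Nikodym requires. *)
Definition sf_measure & sigma_finite setT mu : set T -> \bar R := mu.

Let sf_measure0 : sf_measure sf_mu set0 = 0%E. Proof. exact: measure0. Qed.
Let sf_measure_ge0 A : (0 <= sf_measure sf_mu A)%E. Proof. exact: measure_ge0. Qed.
Let sf_measure_sigma_additive : semi_sigma_additive (sf_measure sf_mu).
Proof. exact: measure_semi_sigma_additive. Qed.
HB.instance Definition _ := isMeasure.Build _ _ _ (sf_measure sf_mu)
  sf_measure0 sf_measure_ge0 sf_measure_sigma_additive.
HB.instance Definition _ := Measure_isSigmaFinite.Build _ _ _ (sf_measure sf_mu) sf_mu.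

Lemma sf_bounded_density (la : {charge set T -> \bar R}) (C : R) : 0 <= C ->
  (forall A, measurable A -> (`|la A| <= C%:E * mu A)%E) ->
  exists g, [/\ mu.-integrable setT (EFin \o g), (forall x, `|g x| <= C) &
    forall A, measurable A -> la A = (\int[mu]_(x in A) (g x)%:E)%E].
Proof. exact: (@bounded_density _ _ _ (sf_measure sf_mu)). Qed.
End SigmaFiniteDensity.

Section HaarSupport.
Variables (R : realType) (k : finFieldType) (m n : nat).
Local Notation V := 'M[laurent k]_(m, n).

Lemma haar_sigma_finite (nu : {measure set (borel V) -> \bar R}) :
  is_haar nu -> sigma_finite setT nu.
Proof.
move=> hnu; exists (fun i : nat => box (- i%:Z) : set (borel V)).
  by apply/seteqP; split => // X _; have [N XN] := box_ex X; exists N.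
by move=> i; split; [exact: measurable_box|rewrite haar_box_fin].
Qed.

Lemma locally_constant_cs_bounded (f : V -> R[i]) :
  locally_constant f -> compactly_supported f ->
  exists (N : nat) (L : R), 0 <= L /\ forall X,
    [/\ f X != 0 -> box (- N%:Z) X, `|complex.Re (f X)| <= L &
        `|complex.Im (f X)| <= L].
Proof.
move=> lf cf; have [N KN] := compact_sub_box cf.
have [L KL] : exists L : nat, forall X, closure [set X | f X != 0] X ->
    `|complex.Re (f X)| + `|complex.Im (f X)| <= L%:R.
  have : \forall i \near \oo, closure [set X | f X != 0] `<=`
      [set X | `|complex.Re (f X)| + `|complex.Im (f X)| <= (i : nat)%:R].
    move/compact_near_coveringP : cf; apply => X _.
    pose b := `|complex.Re (f X)| + `|complex.Im (f X)|.
    have fX := lf X.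
    exists ([set Y | f Y = f X], [set j | (Num.truncn b < j)%N]).
      by split => //; exists (Num.truncn b).+1.
    move=> [Y j] [/= -> bj]; apply/ltW/(lt_le_trans (truncnS_gt _)).
    by rewrite ler_nat.
  by case=> L _ LP; exists L => X KX; exact: (LP L (leqnn L) X KX).
exists N, L%:R; split => // X.
have [f0|f0] := eqVneq (f X) 0; first by rewrite f0 /= normr0; split.
have fX : closure [set X | f X != 0] X by exact: subset_closure.
split => [_||]; first exact: KN.
  by apply: le_trans (KL X fX); rewrite lerDl.
by apply: le_trans (KL X fX); rewrite lerDr.
Qed.
End HaarSupport.

(** * Densities of pushforwards, and the conclusion *)

Section ChevalleyDensity.
Variables (R : realType) (k : finFieldType) (n : nat).
Local Notation V := 'M[laurent k]_n.

(** The pushforward of h times nu is a charge whose absolute value on A is at most L times the mass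
    of the part of the preimage inside [box (- s)], hence at most L K nu'(A) by
    [le_chevalley_haar]. *)
Lemma chevalley_density (nu : {measure set (borel V) -> \bar R})
    (nu' : {measure set (borel 'rV[laurent k]_n) -> \bar R}) (h : borel V -> R)
    (s : int) (L : R) :
  is_haar nu -> is_haar nu' -> (0 < n)%N -> 0 <= s -> 0 <= L ->
  nu.-integrable setT (EFin \o h) ->
  (forall X, h X != 0 -> box (- s) X) -> (forall X, `|h X| <= L) ->
  exists (g : borel 'rV[laurent k]_n -> R) (C : R),
    [/\ nu'.-integrable setT (EFin \o g), (forall x, `|g x| <= C) &
      forall A : set (borel 'rV[laurent k]_n), measurable A ->
        (\int[nu]_(X in @chevalley (laurent k) n @^-1` A) (h X)%:E =
         \int[nu']_(x in A) (g x)%:E)%E].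
Proof.
move=> hnu hnu' n0 s0 L0 inth hs hL.
have [K K0 le_nu] := le_chevalley_haar hnu hnu' n0 s0.
have mh : measurable_fun setT h by apply/measurable_EFinP; exact: measurable_int inth.
have mchi := @measurable_chevalley k n.
have [la laE] := push_charge_ex mchi inth.
have mb : measurable (box (- s) : set (borel V)) by exact: measurable_box.
have [|A mA|g [intg gC lag]] :=
    @sf_bounded_density _ _ R nu' (haar_sigma_finite hnu') la (L * K).
- exact: mulr_ge0.
- have mcA : measurable (@chevalley (laurent k) n @^-1` A : set (borel V)).
    by rewrite -[X in measurable X]setTI; exact: mchi.
  rewrite laE; apply: le_trans (le_abse_integral _ _ _) _ => //.
    by apply/measurable_EFinP; exact: measurable_funTS.
  rewrite EFinM -muleA.
  apply: (@le_trans _ _ (\int[nu]_(X in @chevalley (laurent k) n @^-1` A)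
      (L%:E * (\1_(box (- s) : set V) X)%:E))%E).
    apply: ge0_le_integral => //.
    - by apply: measurableT_comp => //; apply/measurable_EFinP; exact: measurable_funTS.
    - by apply: measurable_funeM; apply/measurable_EFinP; exact: measurable_indic.
    - move=> X _; rewrite -EFinM lee_fin indicE.
      have [hX|hX] := eqVneq (h X) 0; first by rewrite hX normr0 mulr_ge0.
      by rewrite mem_set ?mulr1//; exact: hs.
  rewrite ge0_integralZl_EFin//; last first.
    by apply/measurable_EFinP; exact: measurable_indic.
  rewrite integral_indic// setIC lee_wpmul2l ?lee_fin//; exact: le_nu.
exists g, (L * K); split => // A mA.
by rewrite -lag// laE.
Qed.
End ChevalleyDensity.

Lemma Linfty_bounded d (T : measurableType d) (R : realType)
    (nu : {measure set T -> \bar R}) (u v : T -> R) (C : R) :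
  measurable_fun setT u -> measurable_fun setT v ->
  (forall x, `|u x| <= C) -> (forall x, `|v x| <= C) ->
  Linfty nu (fun x => (u x +i* v x)%C).
Proof.
move=> mu mv uC vC; split => //; rewrite /finite_norm unlock /=.
case: ifPn => // _.
apply: (@le_lt_trans _ _ (C + C)%:E); last exact: ltry.
apply/ess_supP; apply: nearW => x /=; rewrite lee_fin ger0_norm ?sqrtr_ge0//.
have CC : 0 <= C + C.
  by rewrite addr_ge0// (le_trans _ (uC x)).
rewrite -(ger0_norm CC) -sqrtr_sqr ler_sqrt ?sqr_ge0//.
rewrite -(real_normK (num_real (u x))) -(real_normK (num_real (v x))).
have := uC x; have := vC x; have := normr_ge0 (u x); have := normr_ge0 (v x).
move: `|u x| `|v x| => a b *; nra.
Qed.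

Theorem theoremE (R : realType) (k : finFieldType) (p n : nat)
    (hp : p \in [pchar k]) (hn : (1 <= n)%N) (hpn : (n < p.*2)%N)
    (mu : set (borel 'M[laurent k]_n) -> R[i]) :
  smooth_cs_measure mu ->
  exists (nu : {measure set (borel 'rV[laurent k]_n) -> \bar R})
         (g : borel 'rV[laurent k]_n -> R[i]),
    [/\ is_haar nu, Linfty nu g &
        has_density nu
          (fun B : set (borel 'rV[laurent k]_n) =>
             mu (@chevalley (laurent k) n @^-1` B)) g].
Proof.
clear hp hpn; case: n hn mu => // n n0 mu [nu0] [f] [hnu0 lf cf [[intRe intIm] muE]].
have [nu hnu] := haar_row_ex hnu0.
have [N [L [L0 fNL]]] := locally_constant_cs_bounded lf cf.
have fRe X : complex.Re (f X) != 0 -> box (- N%:Z) X.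
  by move=> fX; have [+ _ _] := fNL X; apply; apply: contraNneq fX => ->.
have fIm X : complex.Im (f X) != 0 -> box (- N%:Z) X.
  by move=> fX; have [+ _ _] := fNL X; apply; apply: contraNneq fX => ->.
have LRe X : `|complex.Re (f X)| <= L by have [] := fNL X.
have LIm X : `|complex.Im (f X)| <= L by have [] := fNL X.
have N0 : 0 <= N%:Z by [].
(* Real and imaginary parts are treated separately, with the same Haar measure [nu] on rows. *)
have [u [Cu [intu uC uE]]] := chevalley_density hnu0 hnu n0 N0 L0 intRe fRe LRe.
have [v [Cv [intv vC vE]]] := chevalley_density hnu0 hnu n0 N0 L0 intIm fIm LIm.
exists nu, (fun x => (u x +i* v x)%C); split => //.
  apply: (@Linfty_bounded _ _ _ _ _ _ (Num.max Cu Cv)).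
  - by apply/measurable_EFinP; exact: measurable_int intu.
  - by apply/measurable_EFinP; exact: measurable_int intv.
  - by move=> x; rewrite le_max uC.
  - by move=> x; rewrite le_max vC orbT.
split => // A mA; rewrite muE; last first.
  by rewrite -[X in measurable X]setTI; exact: measurable_chevalley.
by rewrite /cintegral /Rintegral uE// vE.
Qed.
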